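(* Let $k$ be a fixed positive integer. Then, as $n\to\infty$, the maximum number of directed cycles of length $4k$ in an $n$-vertex tournament is equal to $$\left(1+2\sum_{i=1}^{\infty}\left(\frac{2}{(2i-1)\pi}\right)^{4k}+o(1)\right)\frac{(4k-1)!}{2^{4k}}\binom{n}{4k}.$$ In other words, $c(4k)=1+2\sum_{i=1}^{\infty}\left(\frac{2}{(2i-1)\pi}\right)^{4k}$. Furthermore, this maximum is asymptotically attained by the carousel tournament; that is, the number of directed cycles of length $4k$ in $\mathrm{Car}_n$ is also equal to $$\left(1+2\sum_{i=1}^{\infty}\left(\frac{2}{(2i-1)\pi}\right)^{4k}+o(1)\right)\frac{(4k-1)!}{2^{4k}}\binom{n}{4k}$$ as $n\to\infty$.
   Context: A tournament is an orientation of a complete graph. A directed cycle of length $\ell$ in a tournament is a (not necessarily induced) subgraph that is a directed cycle on $\ell$ distinct vertices; cycles are counted as subgraphs (without a distinguished starting vertex). Let $C(n,\ell)$ be the maximum number of directed cycles of length $\ell$ in an $n$-vertex tournament, let $R(n,\ell)=\frac{(\ell-1)!}{2^{\ell}}\binom{n}{\ell}$ (the expected number of directed cycles of length $\ell$ in the uniformly random $n$-vertex tournament), and let $c(\ell)=\lim_{n\to\infty}\frac{C(n,\ell)}{R(n,\ell)}$. For odd $n$, the carousel tournament $\mathrm{Car}_n$ is the tournament with vertex set $\mathbb{Z}/n\mathbb{Z}$ in which there is a directed edge from $i$ to $j$ if and only if $j-i\in\{\overline{1},\dots,\overline{\tfrac{n-1}{2}}\}$. For even $n$, $\mathrm{Car}_n$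 is obtained from $\mathrm{Car}_{n+1}$ by deleting one vertex. *)

(* Defs.v *)
From mathcomp Require Import all_boot all_order all_algebra.
From mathcomp Require Import all_classical all_reals all_analysis.
Set Implicit Arguments.
Unset Strict Implicit.
Unset Printing Implicit Defensive.
Import Order.TTheory GRing.Theory Num.Theory numFieldNormedType.Exports.

(* A digraph on T is given by its set of arcs; (x, y) is the arc from x to y. *)
Definition tournament (T : finType) (D : {set T * T}) : bool :=
  [forall x, (x, x) \notin D] &&
  [forall x, forall y, (x != y) ==> ((x, y) \in D) (+) ((y, x) \in D)].

Definition cycle_arcs (T : finType) (c : seq T) : {set T * T} :=
  [set a : T * T | (a.1 \in c) && (a.2 == next c a.1)].

(* A directed cycle is identified with its arc set, so that the l rotations of
   a cyclic sequence of l distinct vertices count as one cycle. *)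
Definition dicycles (T : finType) (D : {set T * T}) (l : nat) :
    {set {set T * T}} :=
  [set cycle_arcs c | c : l.-tuple T
     & uniq c && cycle (fun x y => (x, y) \in D) c].

Definition max_dicycles (n l : nat) : nat :=
  \max_(D : {set 'I_n * 'I_n} | tournament D) #|dicycles D l|.

(* The difference a.2 - a.1 is taken in the additive group 'I_m.+1 of integers
   modulo m.+1; m is meant to be even, so that m./2 = ((m.+1) - 1) / 2. *)
Definition odd_carousel (m : nat) : {set 'I_m.+1 * 'I_m.+1} :=
  [set a : 'I_m.+1 * 'I_m.+1 | 1 <= ((a.2 - a.1)%R : 'I_m.+1) <= m./2].

Definition delete_vertex (m : nat) (v : 'I_m.+1) (D : {set 'I_m.+1 * 'I_m.+1}) :
    {set 'I_m * 'I_m} :=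
  [set a : 'I_m * 'I_m | (lift v a.1, lift v a.2) \in D].

(* Odd carousels are vertex-transitive, so the choice of the deleted vertex is
   immaterial. *)
Definition carousel (n : nat) : {set 'I_n * 'I_n} :=
  match n with
  | 0 => delete_vertex ord_max (odd_carousel 0)
  | m.+1 => if odd m.+1 then odd_carousel m
            else delete_vertex ord_max (odd_carousel m.+1)
  end.

Local Open Scope ring_scope.
Local Open Scope classical_set_scope.

Definition expected_dicycles (R : realType) (n l : nat) : R :=
  (l.-1)`!%:R / 2 ^+ l * 'C(n, l)%:R.

Definition dicycle_ratio (R : realType) (l : nat) : R^nat :=
  fun n => (max_dicycles n l)%:R / expected_dicycles R n l.

Definition dicycle_limit (R : realType) (l : nat) : R :=
  limn (dicycle_ratio R l).

Definition pi_partial_sum (R : realType) (l : nat) : R^nat :=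
  fun n => \sum_(1 <= i < n.+1) (2 / ((2 * i%:R - 1) * pi)) ^+ l.

(* Main.v *)
(** Let [S] be the skew-symmetric +-1 matrix of a tournament on [n] vertices,
    [J] the all-ones matrix and [p = 4k].  Closed walks of length [p] are counted
    by the trace of [((S + J) / 2)^p] up to non-injective walks, which are
    asymptotically negligible.

    A Schur form of [S + J] has diagonal entries [g_i + i w_i], where [g_i >= 0],
    the sum of the [g_i] is [n] and [w_i] is a diagonal entry of the Hermitian
    matrix [-iS] in a unitary basis; non-real eigenvalues come in conjugate pairs,
    so there [g_i <= n / 2] and [w_i^2 <= n^2 / 2].  Convexity of the moments of
    [-iS] then yields [tr (S + J)^p <= n^p + tr S^p].

    For [tr S^p] the key is majorization.  If the [u] largest values of [|f|] sum
    up to at most [g_1 + ... + g_u] for every [u], then the same holds for [S f]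
    and [K g], where [K] is the Hankel matrix with entries 1 above, 1/2 on and 0
    below the antidiagonal: by skew symmetry the sum of [+- S x y] over a rectangle
    [U x V] is at most [u v - (u + v - n)_+^2 / 2], the sum of [K] over a corner.
    Starting from a row of [S], this bounds [tr S^p] by [n |K^(p/2-1) 1|^2], and
    [K] is diagonalized by the discrete cosine transform, with eigenvalues
    [+- cot ((2j+1) pi / 4n) / 2], close to [2 n / ((2j+1) pi)].

    For the carousel [S J = 0] and [S] is circulant, with eigenvalues
    [+- i cot ((2j+1) pi / 2n)], so both inequalities are asymptotically sharp. *)
Require Import Defs.
From mathcomp Require Import all_boot all_order all_algebra.
From mathcomp Require Import all_classical all_reals all_analysis.
From mathcomp Require Import spectral sesquilinear complex.
From mathcomp Require Import ring lra zify.
Set Implicit Arguments.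
Unset Strict Implicit.
Unset Printing Implicit Defensive.
Import Order.TTheory GRing.Theory Num.Theory numFieldNormedType.Exports.
Local Open Scope ring_scope.

(** * Weak majorization under a skew-symmetric matrix *)

(** The half weight on the antidiagonal makes the corner sums exactly [u v - (u + v - n)_+^2 / 2],
    with no linear correction. *)
Definition hankel_coef (R : realFieldType) (n i j : nat) : R :=
  if (i + j + 2 <= n)%N then 1 else if (i + j + 1 == n)%N then 2^-1 else 0.

(** Ranging over all sets [U] stands in for the decreasing rearrangement of [|f|]; [g] is meant to
    be nonincreasing already. *)
Definition weak_maj (R : realFieldType) (n : nat) (f : 'I_n -> R) (g : nat -> R) :=
  forall U : {set 'I_n}, \sum_(x in U) `|f x| <= \sum_(i < #|U|) g i.

Definition noninc_nonneg (R : realFieldType) (n : nat) (a : nat -> R) :=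
  (forall i, (i.+1 < n)%N -> a i.+1 <= a i) /\ (forall i, (i < n)%N -> 0 <= a i).

Lemma hankel_row_sum (R : realFieldType) (n i v : nat) :
  (i < n)%N -> (v <= n)%N ->
  \sum_(j < v) hankel_coef R n i j =
  if (v + i + 1 <= n)%N then v%:R else n%:R - i%:R - 2^-1.
Proof.
move=> lin; elim: v => [|v IH] lvn.
  by rewrite big_ord0; case: ifP => //; lia.
rewrite big_ord_recr /= IH; last lia.
rewrite /hankel_coef; case: (ltngtP (v + i + 2) n) => h.
- have -> : (v + i + 1 <= n)%N by lia.
  have -> : (i + v + 2 <= n)%N by lia.
  have -> : (v.+1 + i + 1 <= n)%N by lia.
  by rewrite natr1.
- have -> : (i + v + 2 <= n)%N = false by lia.
  have -> : (v.+1 + i + 1 <= n)%N = false by lia.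
  case: ifP => h1.
    have -> : (i + v + 1 == n)%N by lia.
    have -> : n%:R = v%:R + i%:R + 1 :> R.
      by rewrite -natrD natr1; have -> : n = (v + i).+1 by lia.
    lra.
  have -> : (i + v + 1 == n)%N = false by lia.
  by rewrite addr0.
- have -> : (v + i + 1 <= n)%N by lia.
  have -> : (i + v + 2 <= n)%N by lia.
  have -> : (v.+1 + i + 1 <= n)%N by lia.
  by rewrite natr1.
Qed.

Lemma hankel_rect_sum (R : realFieldType) (n u v : nat) :
  (u <= n)%N -> (v <= n)%N ->
  \sum_(i < u) \sum_(j < v) hankel_coef R n i j =
  u%:R * v%:R - ((u + v - n)%:R ^+ 2) / 2.
Proof.
move=> lun lvn; elim: u lun => [|u IH] lun.
  rewrite big_ord0 mul0r; have -> : (0 + v - n = 0)%N by lia. by rewrite expr0n /= mul0r subr0.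
rewrite big_ord_recr /= IH; last lia.
rewrite hankel_row_sum //; case: ifP => h.
  have -> : (u + v - n = 0)%N by lia.
  have -> : (u.+1 + v - n = 0)%N by lia.
  by rewrite -natr1; ring.
have -> : (u.+1 + v - n = (u + v - n).+1)%N by lia.
have -> : (u + v - n)%:R = u%:R + v%:R - n%:R :> R.
  by rewrite natrB ?natrD //; lia.
rewrite -!natr1; have -> : (u + v - n)%:R = u%:R + v%:R - n%:R :> R.
  by rewrite natrB ?natrD //; lia.
by field.
Qed.

(* On the square (U :&: V)^2 the skew-symmetry of S cancels the pairs on which
   e * f takes equal values, and at least #|U| + #|V| - n points lie there. *)
Lemma skew_rect_sum_le (R : realFieldType) (n : nat) (S : 'M[R]_n)
    (U V : {set 'I_n}) (e f : 'I_n -> R) :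
  S^T = - S -> (forall x y, `|S x y| <= 1) ->
  (forall x, `|e x| = 1) -> (forall x, `|f x| = 1) ->
  \sum_(x in U) \sum_(y in V) e x * f y * S x y <=
  \sum_(i < #|U|) \sum_(j < #|V|) hankel_coef R n i j.
Proof.
move=> skS S1 e1 f1.
have SN x y : S y x = - S x y by move/matrixP/(_ x y): skS; rewrite !mxE.
have ee x : e x * e x = 1 by rewrite -expr2 -real_normK ?num_real// e1 expr1n.
have ff x : f x * f x = 1 by rewrite -expr2 -real_normK ?num_real// f1 expr1n.
pose I := U :&: V; pose T x y := e x * f y * S x y.
have cardn (A : {set 'I_n}) : (#|A| <= n)%N by rewrite -[n in (_ <= n)%N]card_ord max_card.
rewrite hankel_rect_sum //.
pose c : R := #|I|%:R.
have cge : (#|U| + #|V| - n <= #|I|)%N.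
  have := cardsUI U V; have := cardn (U :|: V); rewrite -/I; lia.
have cge' : (#|U| + #|V| - n)%:R <= c by rewrite ler_nat.
have sqI : \sum_(x in I) \sum_(y in I) T x y <= c ^+ 2 / 2.
  have -> : \sum_(x in I) \sum_(y in I) T x y =
     2^-1 * \sum_(x in I) \sum_(y in I) S x y * (e x * f y - e y * f x).
    have E : \sum_(x in I) \sum_(y in I) T x y = \sum_(x in I) \sum_(y in I) T y x.
      by rewrite exchange_big.
    have -> : \sum_(x in I) \sum_(y in I) S x y * (e x * f y - e y * f x) =
       \sum_(x in I) \sum_(y in I) T x y + \sum_(x in I) \sum_(y in I) T y x.
      rewrite -big_split; apply: eq_bigr => x _ /=.
      rewrite -big_split; apply: eq_bigr => y _ /=.
      by rewrite /T [S y x]SN; ring.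
    by rewrite -E; field.
  rewrite [leRHS]mulrC ler_pM2l ?invr_gt0 //.
  apply: (@le_trans _ _ (\sum_(x in I) \sum_(y in I) (1 - (e x * f x) * (e y * f y)))).
    apply: ler_sum => x _; apply: ler_sum => y _.
    apply: (le_trans (ler_norm _)); rewrite normrM.
    have -> : e x * f y - e y * f x = e x * f y * (1 - e x * f x * (e y * f y)).
      have -> : e y * f x = (e x * e x) * (f y * f y) * (e y * f x) by rewrite ee ff !mul1r.
      by ring.
    rewrite !normrM e1 f1 !mul1r.
    have h : 0 <= 1 - e x * f x * (e y * f y).
      by rewrite subr_ge0 (le_trans (ler_norm _)) // !normrM !e1 !f1 !mulr1.
    by rewrite (ger0_norm h) -[leRHS]mul1r ler_wpM2r.
  (* With [h = e * f] of values +-1, the double sum of [1 - h x * h y] is [c^2] minus the square of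
     the sum of [h]. *)
  have -> : \sum_(x in I) \sum_(y in I) (1 - (e x * f x) * (e y * f y)) =
     c ^+ 2 - (\sum_(x in I) e x * f x) ^+ 2.
    rewrite [in X in _ - X]expr2 mulr_suml.
    have -> : c ^+ 2 = \sum_(x in I) \sum_(y in I) 1.
      under eq_bigr do rewrite sumr_const.
      by rewrite sumr_const -mulr_natl expr2.
    rewrite -sumrB; apply: eq_bigr => x _.
    by rewrite mulr_sumr -sumrB.
  by rewrite gerBl sqr_ge0.
have indI (x y : 'I_n) : x \in U -> y \in V ->
    T x y <= 1 - ((x \in I) && (y \in I))%:R + (if (x \in I) && (y \in I) then T x y else 0).
  move=> xU yV; case: ifP => _ /=; first by rewrite subrr add0r.
  rewrite subr0 addr0 (le_trans (ler_norm _)) // !normrM e1 f1 !mul1r.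
  exact: S1.
have subE (F : 'I_n -> 'I_n -> R) :
    \sum_(x in U) \sum_(y in V) (if (x \in I) && (y \in I) then F x y else 0) =
    \sum_(x in I) \sum_(y in I) F x y.
  rewrite [RHS]big_mkcond /= [LHS]big_mkcond /=; apply: eq_bigr => x _.
  case: (boolP (x \in U)) => xU; last by rewrite inE (negbTE xU).
  case: (boolP (x \in I)) => xI /=; last by rewrite big1.
  rewrite -big_mkcondr /=; apply: eq_bigl => y.
  by rewrite inE; case: (y \in V); rewrite ?andbF ?andbT.
(* Pairs outside the square on [I] count at most 1 each. The resulting [u v - c^2 / 2] decreases in
   [c], so the lower bound on [c] finishes. *)
apply: (@le_trans _ _ (#|U|%:R * #|V|%:R - c ^+ 2 + c ^+ 2 / 2)); last first.
  have : (#|U| + #|V| - n)%:R ^+ 2 <= c ^+ 2 by rewrite ler_pXn2r ?nnegrE ?ler0n.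
  by lra.
apply: (@le_trans _ _ (\sum_(x in U) \sum_(y in V) (1 - ((x \in I) && (y \in I))%:R +
    (if (x \in I) && (y \in I) then T x y else 0)))).
  by apply: ler_sum => x xU; apply: ler_sum => y yV; exact: indI.
under eq_bigr do rewrite big_split /= sumrB.
rewrite big_split /= sumrB subE; apply: lerD => //.
apply: lerB.
  rewrite (eq_bigr (fun=> #|V|%:R)) => [|x _]; last by rewrite sumr_const.
  by rewrite sumr_const mulr_natl.
have -> : c ^+ 2 = \sum_(x in I) \sum_(y in I) 1.
  under eq_bigr do rewrite sumr_const.
  by rewrite sumr_const -mulr_natl expr2.
rewrite -(subE (fun _ _ => 1)); apply: ler_sum => x _; apply: ler_sum => y _.
by case: ifP.
Qed.

(** * Summation by parts and rearrangement *)

(** Keeping the last weight times the total on the left, instead of 0, is what lets the induction on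
    the length pass. *)
Lemma abel_sum_ge (R : realFieldType) (n : nat) (a z : nat -> R) :
  noninc_nonneg n.+1 a ->
  (forall v, (v <= n.+1)%N -> 0 <= \sum_(i < v) z i) ->
  a n * \sum_(i < n.+1) z i <= \sum_(i < n.+1) a i * z i.
Proof.
elim: n => [|n IH] [dec nng] Z0; first by rewrite !big_ord_recr !big_ord0 /= !add0r.
rewrite big_ord_recr [leRHS]big_ord_recr /= mulrDr lerD2r.
apply: le_trans (IH _ _).
- by rewrite ler_wpM2r ?dec ?Z0 //; lia.
- by split=> [i ?|i ?]; [apply: dec|apply: nng]; lia.
- by move=> v vn; apply: Z0; lia.
Qed.

Lemma abel_sum_le (R : realFieldType) (n : nat) (a b c : nat -> R) :
  noninc_nonneg n a ->
  (forall v, (v <= n)%N -> \sum_(i < v) b i <= \sum_(i < v) c i) ->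
  \sum_(i < n) a i * b i <= \sum_(i < n) a i * c i.
Proof.
case: n => [|n] na bc; first by rewrite !big_ord0.
rewrite -subr_ge0 -sumrB.
under eq_bigr do rewrite -mulrBr.
have Z0 v : (v <= n.+1)%N -> 0 <= \sum_(i < v) (c i - b i).
  by move=> vn; rewrite sumrB subr_ge0 bc.
apply: (le_trans _ (abel_sum_ge (z := fun i => c i - b i) na Z0)).
by rewrite mulr_ge0 ?Z0 // na.2.
Qed.

Lemma noninc_enumeration (R : realFieldType) (n : nat) (d : 'I_n -> R) :
  (forall x, 0 <= d x) ->
  exists s : seq 'I_n, [/\ uniq s, s =i 'I_n, size s = n &
    forall x0, noninc_nonneg n (fun i => d (nth x0 s i))].
Proof.
move=> d0; pose le x y := d y <= d x; exists (sort le (enum 'I_n)).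
have szn : size (sort le (enum 'I_n)) = n by rewrite size_sort size_enum_ord.
split=> //; first by rewrite sort_uniq enum_uniq.
  by move=> x; rewrite mem_sort mem_enum.
move=> x0; split=> [i lin|i _] //.
have tot : total le by move=> x y; exact: le_total.
have /sortedP := sort_sorted tot (enum 'I_n).
by move/(_ x0 i); rewrite szn => /(_ lin).
Qed.

Lemma sum_enumeration (R : realFieldType) (n : nat) (F : 'I_n -> R) (s : seq 'I_n) x0 :
  uniq s -> s =i 'I_n -> size s = n ->
  \sum_x F x = \sum_(i < n) F (nth x0 s i).
Proof.
move=> us ms sz.
rewrite -(big_mkord xpredT (fun i => F (nth x0 s i))).
rewrite -[X in index_iota 0 X]sz -(big_nth x0 xpredT) [RHS]big_uniq //=.
by apply: eq_bigl => x; rewrite ms.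
Qed.

Lemma weak_maj_take (R : realFieldType) (n : nat) (f : 'I_n -> R) (g : nat -> R)
    (s : seq 'I_n) x0 (v : nat) :
  uniq s -> size s = n -> (v <= n)%N -> weak_maj f g ->
  \sum_(i < v) `|f (nth x0 s i)| <= \sum_(i < v) g i.
Proof.
move=> us sz vn /(_ [set x in take v s]).
have szv : size (take v s) = v by rewrite size_take sz; case: ltnP => //; lia.
have uv : uniq (take v s) by rewrite take_uniq.
rewrite cardsE (card_uniqP uv) szv => h; apply: le_trans h.
rewrite (eq_bigl (mem (take v s))) => [|x]; last by rewrite inE.
rewrite -big_uniq //= (big_nth x0) szv big_mkord.
by apply: ler_sum => i _; rewrite nth_take.
Qed.

(* Hardy-Littlewood: sort d decreasingly and sum by parts twice. *)
Lemma weak_maj_dot_le (R : realFieldType) (n : nat) (f d : 'I_n -> R) (g e : nat -> R) :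
  weak_maj f g -> weak_maj d e -> noninc_nonneg n g ->
  \sum_x `|f x| * `|d x| <= \sum_(i < n) g i * e i.
Proof.
case: n f d => [|n] f d fg de ng; first by rewrite !big_ord0.
have [s [us ms sz dec]] := @noninc_enumeration R n.+1 (fun x => `|d x|) (fun x => normr_ge0 _).
rewrite (sum_enumeration _ ord0 us ms sz).
pose a i := `|d (nth ord0 s i)|.
apply: (@le_trans _ _ (\sum_(i < n.+1) a i * g i)).
  under eq_bigr do rewrite mulrC.
  apply: (@abel_sum_le _ _ a (fun i => `|f (nth ord0 s i)|) g (dec ord0)) => v vn.
  exact: weak_maj_take.
under eq_bigr do rewrite mulrC.
by apply: (@abel_sum_le _ _ g a e) => // v vn; exact: weak_maj_take.
Qed.

(** * Weak majorization along iterates *)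

Definition hankel_apply (R : realFieldType) (n : nat) (g : nat -> R) (i : nat) : R :=
  \sum_(j < n) hankel_coef R n i j * g j.

Definition skew_apply (R : realFieldType) (n : nat) (S : 'M[R]_n) (f : 'I_n -> R) (x : 'I_n) : R :=
  \sum_y S x y * f y.

Lemma hankel_coef_ge0 (R : realFieldType) (n i j : nat) : 0 <= hankel_coef R n i j.
Proof. by rewrite /hankel_coef; case: ifP => // _; case: ifP => //; rewrite invr_ge0. Qed.

Lemma hankel_coef_dec (R : realFieldType) (n i j : nat) :
  hankel_coef R n i.+1 j <= hankel_coef R n i j.
Proof.
rewrite /hankel_coef; case: (leqP (i.+1 + j + 2) n) => h.
  by rewrite ifT //; lia.
case: ifP => h1.
  by rewrite ifT; [rewrite invf_le1 // ler1n | lia].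
by case: ifP => // _; case: ifP; rewrite // invr_ge0.
Qed.

Lemma hankel_apply_noninc (R : realFieldType) (n : nat) (g : nat -> R) :
  noninc_nonneg n g -> noninc_nonneg n (hankel_apply n g).
Proof.
move=> [_ g0]; split=> i _.
  by apply: ler_sum => j _; rewrite ler_wpM2r ?hankel_coef_dec // g0.
by apply: sumr_ge0 => j _; rewrite mulr_ge0 ?hankel_coef_ge0 // g0.
Qed.

Lemma exists_sign (R : realFieldType) (T : Type) (F : T -> R) :
  exists e : T -> R, (forall x, `|e x| = 1) /\ (forall x, `|F x| = e x * F x).
Proof.
exists (fun x => if 0 <= F x then 1 else -1); split=> x; case: ifP => h.
- by rewrite normr1.
- by rewrite normrN1.
- by rewrite mul1r ger0_norm.
- by rewrite mulN1r ltr0_norm // ltNge h.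
Qed.

(** Duality: with the signs [e] of [S f], its absolute sum over [U] is the pairing of [f] with the
    signed column sums [d] of [S]. The rectangle bound says that [d] is weakly majorized by the
    column sums of the first [#|U|] rows of the Hankel matrix, and Hardy-Littlewood combines the two
    majorizations. *)
Lemma weak_maj_skew (R : realFieldType) (n : nat) (S : 'M[R]_n) (f : 'I_n -> R) (g : nat -> R) :
  S^T = - S -> (forall x y, `|S x y| <= 1) -> noninc_nonneg n g ->
  weak_maj f g -> weak_maj (skew_apply S f) (hankel_apply n g).
Proof.
move=> skS S1 ng fg U.
have [e [e1 eE]] := exists_sign (skew_apply S f).
pose d y := \sum_(x in U) e x * S x y.
have -> : \sum_(x in U) `|skew_apply S f x| = \sum_y f y * d y.
  under eq_bigr do rewrite eE /skew_apply mulr_sumr.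
  rewrite exchange_big; apply: eq_bigr => y _ /=.
  by rewrite /d mulr_sumr; apply: eq_bigr => x _; ring.
apply: (@le_trans _ _ (\sum_y `|f y| * `|d y|)).
  by apply: ler_sum => y _; rewrite -normrM ler_norm.
have dmaj : weak_maj d (fun j => \sum_(i < #|U|) hankel_coef R n i j).
  move=> V; have [c [c1 cE]] := exists_sign d.
  rewrite [leRHS]exchange_big /=.
  apply: le_trans (skew_rect_sum_le U V skS S1 e1 c1).
  rewrite exchange_big /= ler_sum // => y _.
  by rewrite cE /d mulr_sumr ler_sum // => x _; rewrite mulrCA mulrA.
apply: le_trans (weak_maj_dot_le fg dmaj ng) _.
rewrite /hankel_apply exchange_big /= ler_sum // => j _.
by rewrite mulrC mulr_suml.
Qed.

Lemma weak_maj_iter (R : realFieldType) (n : nat) (S : 'M[R]_n) (f : 'I_n -> R) (k : nat) :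
  S^T = - S -> (forall x y, `|S x y| <= 1) -> (forall x, `|f x| <= 1) ->
  weak_maj (iter k (skew_apply S) f) (iter k (hankel_apply n) (fun=> 1)) /\
  noninc_nonneg n (iter k (hankel_apply n) (fun=> 1 : R)).
Proof.
move=> skS S1 f1; elim: k => [|k [IH1 IH2]] /=; last first.
  by split; [exact: weak_maj_skew | exact: hankel_apply_noninc].
split; last by split=> i _ //.
move=> U; rewrite sumr_const card_ord.
by rewrite -[leRHS]sumr_const ler_sum.
Qed.

(** Hardy-Littlewood for the iterate paired with itself. *)
Lemma iter_skew_sqr_sum_le (R : realFieldType) (n : nat) (S : 'M[R]_n) (f : 'I_n -> R) (k : nat) :
  S^T = - S -> (forall x y, `|S x y| <= 1) -> (forall x, `|f x| <= 1) ->
  \sum_x iter k (skew_apply S) f x ^+ 2 <=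
  \sum_(i < n) iter k (hankel_apply n) (fun=> 1) i ^+ 2.
Proof.
move=> skS S1 f1; have [m ng] := weak_maj_iter k skS S1 f1.
rewrite (eq_bigr (fun x => `|iter k (skew_apply S) f x| * `|iter k (skew_apply S) f x|)).
  under [leRHS]eq_bigr do rewrite expr2.
  exact: weak_maj_dot_le.
by move=> x _; rewrite -expr2 real_normK ?num_real.
Qed.

(** * Traces of powers of S + J *)

Local Open Scope sesquilinear_scope.

(** The sequence [q (3/4)^(q-1)] is largest at [q = 3] and [q = 4], where it equals 27/16; from 3 on
    it does not increase. *)
Lemma mul_exp3_le (q : nat) : (0 < q)%N -> (q * 3 ^ q.-1 <= 2 * 4 ^ q.-1)%N.
Proof.
case: q => // q _; rewrite /=.
have E k : (3 <= k)%N -> (k * 3 ^ k.-1 <= 2 * 4 ^ k.-1)%N.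
  elim: k => // k IH; rewrite leq_eqVlt => /predU1P[<- //|k3].
  have {IH} := IH k3; case: k k3 => // k k3 /=.
  by rewrite !expnS; move: (3 ^ k)%N (4 ^ k)%N => a b; nia.
by case: q => [//|[//|q]]; exact: (E q.+3).
Qed.

(** Meant for a non-real eigenvalue, with [g] its real part and [w] the square of its imaginary
    part. The hypotheses give [X = g^2 + w <= 3/4 N^2]. Factoring [X^q - w^q] leaves at most
    [g^2 q X^(q-1)]; one factor [g] is at most [N / 2], and [q (3/4)^(q-1) <= 2] absorbs the
    rest. *)
Lemma expr_add_sqr_le (F : numFieldType) (g w N : F) (q : nat) : (0 < q)%N ->
  0 <= g -> 0 <= w -> 0 <= N -> 2 * g <= N -> 2 * w <= N ^+ 2 ->
  (g ^+ 2 + w) ^+ q <= g * N ^+ (2 * q).-1 + w ^+ q.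
Proof.
move=> q0 g0 w0 N0 gN wN.
have g2 : 4 * g ^+ 2 <= N ^+ 2.
  rewrite (_ : 4 * g ^+ 2 = (2 * g) ^+ 2); last by ring.
  by rewrite lerXn2r ?nnegrE ?mulr_ge0.
set X := g ^+ 2 + w.
have X0 : 0 <= X by rewrite addr_ge0 ?exprn_ge0.
have wX : w <= X by rewrite lerDr exprn_ge0.
have XN : 4 * X <= 3 * N ^+ 2.
  rewrite mulrDr (_ : 3 * N ^+ 2 = N ^+ 2 + 2 * N ^+ 2); last by ring.
  rewrite lerD // (_ : 4 * w = 2 * (2 * w)); last by ring.
  by rewrite ler_pM2l.
rewrite -lerBlDr subrXX (_ : X - w = g ^+ 2); last by rewrite /X; ring.
apply: (@le_trans _ _ (g ^+ 2 * (X ^+ q.-1 *+ q))).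
  rewrite ler_wpM2l ?exprn_ge0 //.
  have -> : X ^+ q.-1 *+ q = \sum_(i < q) X ^+ q.-1 by rewrite sumr_const card_ord.
  apply: ler_sum => i _.
  have -> : X ^+ q.-1 = X ^+ (q.-1 - i) * X ^+ i.
    by rewrite -exprD subnK //; have := ltn_ord i; lia.
  rewrite ler_pM ?exprn_ge0 ?lerXn2r //.
have p4 : 0 < (4 : F) ^+ q.-1 by rewrite exprn_gt0.
rewrite -(ler_pM2l (_ : 0 < 2 * 4 ^+ q.-1)) ?mulr_gt0 //.
apply: (@le_trans _ _ (2 * 4 ^+ q.-1 * (g * (N * N ^+ 2 ^+ q.-1)))); last first.
  by rewrite -exprM -exprS (_ : (2 * q.-1).+1 = (2 * q).-1)%N //; lia.
apply: (@le_trans _ _ ((q * 3 ^ q.-1)%:R * (g * (N * N ^+ 2 ^+ q.-1)))); last first.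
  rewrite ler_wpM2r ?mulr_ge0 ?exprn_ge0 // -natrX -natrM ler_nat.
  exact: mul_exp3_le.
rewrite (_ : 2 * 4 ^+ q.-1 * (g ^+ 2 * (X ^+ q.-1 *+ q)) =
   q%:R * (g * ((2 * g) * (4 * X) ^+ q.-1))); last first.
  by rewrite exprMn -[_ *+ q]mulr_natl; ring.
rewrite natrM -[leRHS]mulrA ler_wpM2l // [leRHS]mulrCA ler_wpM2l // natrX.
rewrite [leRHS]mulrCA -exprMn ler_pM ?mulr_ge0 ?exprn_ge0 ?mulr_ge0 //.
by rewrite lerXn2r ?nnegrE ?mulr_ge0 ?exprn_ge0.
Qed.

(** The ratios [b (r+1) / b r] are nondecreasing, hence all at least [b 1]. The product form
    [b 1 * b r <= b r.+1] survives vanishing terms, since a zero forces the next term to be zero. *)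
Lemma log_convex_ge (F : numFieldType) (b : nat -> F) (q : nat) :
  (forall q, 0 <= b q) -> b 0%N = 1 -> (forall q, b q.+1 ^+ 2 <= b q * b q.+2) ->
  b 1%N ^+ q <= b q.
Proof.
move=> bge b01 lc.
have step r : b 1%N * b r <= b r.+1.
  elim: r => [|r IH]; first by rewrite b01 mulr1.
  have := bge r; rewrite le_eqVlt => /predU1P[br|br].
    have : b r.+1 ^+ 2 == 0.
      by rewrite eq_le exprn_ge0 // andbT (le_trans (lc r)) // -br mul0r.
    by rewrite sqrf_eq0 => /eqP ->; rewrite mulr0.
  rewrite -(ler_pM2l br) (le_trans _ (lc r)) // mulrCA mulrA expr2.
  by rewrite ler_wpM2r.
elim: q => [|q IH]; first by rewrite expr0 b01.
by rewrite exprS (le_trans _ (step q)) // ler_wpM2l.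
Qed.

(** * Triangular matrices and unitary conjugation *)

Lemma trig_mul (F : fieldType) (n : nat) (A B : 'M[F]_n) :
  is_trig_mx A -> is_trig_mx B ->
  is_trig_mx (A *m B) /\ (forall i, (A *m B) i i = A i i * B i i).
Proof.
move=> /is_trig_mxP tA /is_trig_mxP tB; split.
  apply/is_trig_mxP => i j ij; rewrite mxE big1 // => l _.
  case: (ltnP i l) => il; first by rewrite tA ?mul0r.
  by rewrite tB ?mulr0 // (leq_ltn_trans il).
move=> i; rewrite mxE (bigD1 i) //= big1 ?addr0 // => l li.
case: (ltnP i l) => il; first by rewrite tA ?mul0r.
by rewrite tB ?mulr0 // ltn_neqAle il (contraNneq _ li) // => /val_inj ->.
Qed.

Lemma trig_exp (F : fieldType) (n m : nat) (A : 'M[F]_n) :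
  is_trig_mx A ->
  is_trig_mx (A ^+ m) /\ (forall i, (A ^+ m) i i = A i i ^+ m).
Proof.
move=> tA; elim: m => [|m [IH1 IH2]].
  split=> [|i]; first by rewrite expr0; exact: scalar_mx_is_trig.
  by rewrite !expr0 mxE eqxx.
rewrite exprS; have [h1 h2] := trig_mul tA IH1; split=> // i.
by rewrite [LHS]h2 IH2 exprS.
Qed.

Lemma unitarymx_tmulC (C : numClosedFieldType) (n : nat) (P : 'M[C]_n) :
  P \is unitarymx -> P^t* *m P = 1%:M.
Proof. by move=> PU; apply: mulmx1C; exact/unitarymxP. Qed.

Lemma unitary_conj_exp (C : numClosedFieldType) (n m : nat) (P A : 'M[C]_n) :
  P \is unitarymx -> (P *m A *m P^t*) ^+ m = P *m A ^+ m *m P^t*.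
Proof.
move=> PU; elim: m => [|m IH]; first by rewrite !expr0 mulmx1; exact/esym/unitarymxP.
rewrite exprS IH [A ^+ m.+1]exprS /GRing.mul /=.
by rewrite !mulmxA -[_ *m P^t* *m P]mulmxA unitarymx_tmulC // mulmx1.
Qed.

Lemma unitary_conj_trace (C : numClosedFieldType) (n : nat) (P A : 'M[C]_n) :
  P \is unitarymx -> \tr (P *m A *m P^t*) = \tr A.
Proof. by move=> PU; rewrite mxtrace_mulC mulmxA unitarymx_tmulC // mul1mx. Qed.

(* The moments |u G^q|^2 of a skew-Hermitian G are log-convex in q. *)
Lemma skewherm_diag_exp_ge (C : numClosedFieldType) (n k : nat) (G : 'M[C]_n) (i : 'I_n) :
  G^t* = - G ->
  (`|G i i| ^+ 2) ^+ (2 * k) <= (G ^+ (4 * k)) i i.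
Proof.
move=> Gt.
have Gqt q : (G ^+ q)^t* = (-1) ^+ q *: G ^+ q.
  elim: q => [|q IH]; first by rewrite !expr0 scale1r trmx1 map_mx1.
  rewrite [in LHS]exprSr trmx_mul map_mxM IH Gt mulNmx -scalemxAr -scaleNr.
  by rewrite -mulN1r -exprS [G ^+ q.+1]exprS.
(* Up to sign the inner product depends on [q + r] only; this turns Cauchy-Schwarz between [q] and
   [q.+2] into log-convexity. *)
have dotE q r : dotmx (row i (G ^+ q)) (row i (G ^+ r)) = (-1) ^+ r * (G ^+ (q + r)) i i.
  have -> : (G ^+ (q + r)) i i = \sum_l (G ^+ q) i l * (G ^+ r) l i by rewrite exprD mxE.
  rewrite dotmxE tr_row map_col Gqt mxE mulr_sumr.
  by apply: eq_bigr => l _; rewrite !mxE mulrCA.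
pose b q := dotmx (row i (G ^+ q)) (row i (G ^+ q)).
have b0 q : 0 <= b q.
  rewrite /b dotmxE mxE sumr_ge0 // => l _.
  by rewrite !mxE mul_conjC_ge0.
have lc q : b q.+1 ^+ 2 <= b q * b q.+2.
  have cs : `|dotmx (row i (G ^+ q)) (row i (G ^+ q.+2))| ^+ 2 <= b q * b q.+2.
    by case: (CauchySchwarz (@dotmx C n) (row i (G ^+ q)) (row i (G ^+ q.+2))).
  apply: le_trans cs; rewrite -[b q.+1]ger0_norm ?b0 // /b !dotE !normrM !normrX.
  by rewrite normrN1 !expr1n !mul1r (_ : q.+1 + q.+1 = q + q.+2)%N //; lia.
have b01 : b 0%N = 1 by rewrite /b dotE !expr0 mul1r mxE eqxx.
have b1 : `|G i i| ^+ 2 <= b 1%N.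
  rewrite /b dotmxE !mxE (bigD1 i) //= !mxE expr1 -normCK lerDl sumr_ge0 // => l _.
  by rewrite !mxE mul_conjC_ge0.
have bE : (G ^+ (4 * k)) i i = b (2 * k)%N.
  rewrite /b dotE -signr_odd oddM /= expr0 mul1r.
  by rewrite (_ : 4 * k = 2 * k + 2 * k)%N //; lia.
rewrite bE (le_trans _ (log_convex_ge (2 * k) b0 b01 lc)) //.
by rewrite lerXn2r ?nnegrE ?exprn_ge0.
Qed.

Lemma eigenvalue_trig (F : fieldType) (n : nat) (T : 'M[F]_n) (a : F) :
  is_trig_mx T -> eigenvalue T a = [exists j, a == T j j].
Proof.
move=> tT; rewrite eigenvalue_root_char char_poly_trig //.
rewrite /root horner_prod prodf_seq_eq0 /=.
apply/hasP/existsP => [[j _ /=]|[j aj]].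
  by rewrite hornerXsubC subr_eq0 => aj; exists j.
by exists j; rewrite ?mem_index_enum //= hornerXsubC subr_eq0.
Qed.

Lemma eigenvalue_unitary_conj (C : numClosedFieldType) (n : nat) (P A : 'M[C]_n) (a : C) :
  P \is unitarymx -> eigenvalue (P *m A *m P^t*) a = eigenvalue A a.
Proof.
move=> PU; have Pu := unitarymx_unit PU.
apply/eigenvalueP/eigenvalueP => -[v vE v0].
  exists (v *m P); last first.
    by apply: contraNneq v0 => vP0; rewrite -(mulmxtVK v PU) vP0 mul0mx.
  have := congr1 (mulmx^~ P) vE.
  by rewrite !mulmxA -[_ *m P^t* *m P]mulmxA unitarymx_tmulC // mulmx1 scalemxAl.
exists (v *m P^t*).
  rewrite !mulmxA -[_ *m P^t* *m P]mulmxA unitarymx_tmulC // mulmx1 vE.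
  by rewrite scalemxAl.
by apply: contraNneq v0 => vP0; rewrite -(mulmxKtV v PU) // vP0 mul0mx.
Qed.

(** The characteristic polynomial of [A] has real coefficients, and its roots are the diagonal
    entries of the triangular form. *)
Lemma conj_eig_diag (C : numClosedFieldType) (n : nat) (P A : 'M[C]_n) (i : 'I_n) :
  P \is unitarymx -> A ^ Num.conj = A -> is_trig_mx (P *m A *m P^t*) ->
  exists j, (P *m A *m P^t*) j j = ((P *m A *m P^t*) i i)^*.
Proof.
move=> PU Ar tT; set T := P *m A *m P^t* in tT *.
have rt x : root (char_poly A) x = [exists j, x == T j j].
  by rewrite -eigenvalue_root_char -(eigenvalue_unitary_conj A x PU) eigenvalue_trig.
have : root (char_poly A) (T i i) by rewrite rt; apply/existsP; exists i.
rewrite -(fmorph_root Num.conj) map_char_poly /= Ar rt => /existsP[j /eqP h].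
by exists j.
Qed.

(* Schur form of S + J: the eigenvalue attached to the i-th row u of P is
   g i + G i i, with g i = |u 1|^2 >= 0 and G i i = u S u^* purely imaginary. *)
Lemma trace_skewD1_exp_le (C : numClosedFieldType) (n k : nat) (S : 'M[C]_n) :
  (0 < k)%N -> S ^ Num.conj = S -> S^T = - S -> (forall x y, `|S x y| <= 1) ->
  `|\tr ((S + const_mx 1) ^+ (4 * k))| <= n%:R ^+ (4 * k) + \tr (S ^+ (4 * k)).
Proof.
move=> k0 Sr skS S1.
case: (posnP n) => [n0|n0].
  by subst n; rewrite /mxtrace !big_ord0 normr0 addr0 exprn_ge0.
set J : 'M[C]_n := const_mx 1.
have [P PU tT] := Schur (S + J) n0.
rewrite /similar_to /= conjymx // in tT.
set T := P *m (S + J) *m P^t* in tT.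
pose G := P *m S *m P^t*.
pose g i := `|\sum_j P i j| ^+ 2.
have TE i : T i i = g i + G i i.
  rewrite /T mulmxDr mulmxDl mxE addrC; congr (_ + _).
  rewrite mxE /g normCK rmorph_sum /= mulr_sumr; apply: eq_bigr => j _.
  by rewrite !mxE; congr (_ * _); apply: eq_bigr => l _; rewrite mxE mulr1.
have Gt : G^t* = - G.
  rewrite /G !trmx_mul !map_mxM /= trmxCK skS map_mxN Sr.
  by rewrite mulNmx mulmxN mulmxA.
have g0 i : 0 <= g i by rewrite exprn_ge0.
have Gii i : (G i i)^* = - G i i by move/matrixP/(_ i i): Gt; rewrite !mxE.
have gr i : (g i)^* = g i by rewrite geC0_conj.
have normT i : `|T i i| ^+ 2 = g i ^+ 2 + `|G i i| ^+ 2.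
  by rewrite !normCK TE rmorphD /= gr Gii; ring.
have sumg : \sum_i g i = n%:R.
  have : \tr T - \tr G = \tr J.
    by rewrite !unitary_conj_trace // raddfD /= addrAC subrr add0r.
  rewrite /mxtrace -sumrB => E.
  rewrite (eq_bigr (fun i => T i i - G i i)) => [|i _]; last by rewrite TE addrK.
  rewrite E (eq_bigr (fun=> 1)) => [|i _]; last by rewrite mxE.
  by rewrite sumr_const card_ord.
(* The Frobenius norm is invariant under unitary conjugation, and that of [S] is at most [n] because
   its entries are bounded by 1. *)
have sumG : \sum_i `|G i i| ^+ 2 <= n%:R ^+ 2.
  have E : \sum_i \sum_j `|G i j| ^+ 2 = \sum_i \sum_j `|S i j| ^+ 2.
    have frob (A : 'M[C]_n) : \sum_i \sum_j `|A i j| ^+ 2 = \tr (A *m A^t*).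
      by apply: eq_bigr => i _; rewrite mxE; apply: eq_bigr => j _; rewrite !mxE normCK.
    rewrite !frob Gt skS map_mxN Sr !mulmxN !raddfN /=; congr (- _).
    by rewrite -[G *m G]/(G * G) -expr2 unitary_conj_exp // unitary_conj_trace // expr2.
  apply: (@le_trans _ _ (\sum_i \sum_j `|G i j| ^+ 2)).
    apply: ler_sum => i _; rewrite (bigD1 i) //= lerDl.
    by apply: sumr_ge0 => j _; rewrite exprn_ge0.
  rewrite E; apply: (@le_trans _ _ (\sum_(i < n) \sum_(j < n) 1)).
    apply: ler_sum => i _; apply: ler_sum => j _.
    by rewrite exprn_ile1.
  under eq_bigr do rewrite sumr_const card_ord.
  by rewrite sumr_const card_ord -mulrnA -natrX mulnn.
have key i : `|T i i| ^+ (4 * k) <= g i * n%:R ^+ (4 * k).-1 + (`|G i i| ^+ 2) ^+ (2 * k).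
  have -> : (4 * k = 2 * (2 * k))%N by lia.
  rewrite exprM normT.
  have gn : g i <= n%:R.
    by rewrite -sumg (bigD1 i) //= lerDl sumr_ge0.
  (* For a real eigenvalue [g i <= n] suffices. *)
  case: (eqVneq (G i i) 0) => [->|Gi0].
    rewrite normr0 expr0n /= addr0 expr0n (_ : (2 * k == 0)%N = false) ?addr0; last lia.
    have -> : (g i ^+ 2) ^+ (2 * k) = g i * g i ^+ (2 * (2 * k)).-1.
      by rewrite -exprM -exprS prednK //; lia.
    by rewrite ler_wpM2l // lerXn2r ?nnegrE.
  (* For a non-real one the conjugate sits at another diagonal position [j], with the same [g] and
     the opposite [G j j]. Two equal terms share each of the sums [sumg] and [sumG], which yields
     the two factors 2 in the hypotheses of [expr_add_sqr_le]. *)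
  have cA : (S + J) ^ Num.conj = S + J.
    rewrite map_mxD Sr /J map_const_mx; congr (_ + const_mx _); exact: conjC1.
  have [j Tj] := conj_eig_diag i PU cA tT.
  rewrite -/T in Tj.
  have Tij : T i i != T j j.
    apply: contra Gi0; rewrite Tj TE rmorphD /= gr Gii => /eqP /addrI /eqP.
    by rewrite -addr_eq0 -mulr2n mulrn_eq0.
  have ij : j != i by apply: contra Tij => /eqP ->.
  have [gj Gj] : g j = g i /\ G j j = - G i i.
    have h : g j + G j j = g i - G i i by rewrite -TE Tj TE rmorphD /= gr Gii.
    have h' : g j - G j j = g i + G i i.
      by have := congr1 Num.conj h; rewrite rmorphD rmorphB /= !gr !Gii opprK.
    have gE : g j *+ 2 = g i *+ 2.
      transitivity ((g j + G j j) + (g j - G j j)); first by ring.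
      by rewrite h h'; ring.
    have gE' : g j = g i by move/eqP: gE; rewrite eqr_pMn2r // => /eqP.
    by split=> //; move: h; rewrite gE' => /addrI.
  apply: expr_add_sqr_le; rewrite ?exprn_ge0 //; first lia.
    rewrite -sumg (bigD1 i) //= (bigD1 j) //= gj addrA mulr_natl mulr2n lerDl.
    by rewrite sumr_ge0.
  apply: le_trans sumG; rewrite (bigD1 i) //= (bigD1 j) //= Gj normrN addrA.
  by rewrite mulr_natl mulr2n lerDl sumr_ge0 // => x _; rewrite exprn_ge0.
have trE (A : 'M[C]_n) : \tr (A ^+ (4 * k)) = \tr ((P *m A *m P^t*) ^+ (4 * k)).
  by rewrite unitary_conj_exp // unitary_conj_trace.
rewrite (trE (S + J)) (trE S) -/T -/G.
apply: (@le_trans _ _ (\sum_i `|T i i| ^+ (4 * k))).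
  apply: le_trans (ler_norm_sum _ _ _) _; apply: ler_sum => i _.
  by have [_ ->] := trig_exp (4 * k) tT; rewrite normrX.
apply: (@le_trans _ _ (\sum_i (g i * n%:R ^+ (4 * k).-1 + (`|G i i| ^+ 2) ^+ (2 * k)))).
  by apply: ler_sum => i _.
rewrite big_split /= -mulr_suml sumg -exprS prednK ?lerD2l; last lia.
by apply: ler_sum => i _; exact: skewherm_diag_exp_ge.
Qed.

(** The Schur form lives over a closed field, so the inequality is proved over [R[i]] and pulled
    back along the embedding of [R]. *)
Lemma trace_skewD1_exp_le_real (R : rcfType) (n k : nat) (S : 'M[R]_n) : (0 < k)%N ->
  S^T = - S -> (forall x y, `|S x y| <= 1) ->
  \tr ((S + const_mx 1) ^+ (4 * k)) <= n%:R ^+ (4 * k) + \tr (S ^+ (4 * k)).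
Proof.
move=> k0 skS S1; pose toC : {rmorphism R -> R[i]} := real_complex R.
have toCr x : toC x \is Num.real by rewrite complex_real.
have mapX (A : 'M[R]_n) m : map_mx toC (A ^+ m) = map_mx toC A ^+ m.
  elim: m => [|m IH]; first by rewrite !expr0 map_mx1.
  by rewrite [in LHS]exprS map_mxM IH [RHS]exprS.
have Sr : map_mx Num.conj (map_mx toC S) = map_mx toC S.
  by apply/matrixP => x y; rewrite !mxE; exact: (CrealP (toCr _)).
have skC : (map_mx toC S)^T = - map_mx toC S 
  by apply/matrixP => x y; move/matrixP/(_ x y): skS; rewrite !mxE => ->; rewrite rmorphN.
have C1 x y : `|map_mx toC S x y| <= 1.
  rewrite mxE normc_def /= expr0n /= addr0 sqrtr_sqr.
  by rewrite -[1]/(1%:C)%C lecR.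
have := trace_skewD1_exp_le k0 Sr skC C1.
have -> : const_mx 1 = map_mx toC (const_mx 1) :> 'M[R[i]]_n.
  by rewrite map_const_mx; congr const_mx; rewrite rmorph1.
rewrite -map_mxD -!mapX !trace_map_mx -lecR => h.
apply: le_trans (le_trans (real_ler_norm (toCr _)) h) _.
by rewrite -/(toC _) rmorphD rmorphXn rmorph_nat.
Qed.

Local Close Scope sesquilinear_scope.

(** * Spectrum of the extremal Hankel matrix *)

Lemma sin_mvt (R : realType) (x : R) : 0 <= x ->
  exists2 c, 0 <= c <= x & sin x = cos c * x.
Proof.
move=> x0; have [|c] := @MVT_segment R sin cos 0 x x0 (fun y _ => is_derive_sin y).
  by apply: continuous_subspaceT; exact: continuous_sin.
by rewrite in_itv /= sin0 !subr0 => cx ->; exists c.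
Qed.

Lemma sin_le_id (R : realType) (x : R) : 0 <= x -> sin x <= x.
Proof.
by move=> x0; have [c _ ->] := sin_mvt x0; rewrite ler_piMl // cos_le1.
Qed.

(** The mean value point lies below [x], and cosine decreases on [[0, pi]]. *)
Lemma mul_cos_le_sin (R : realType) (x : R) : 0 <= x <= pi -> x * cos x <= sin x.
Proof.
move=> /andP[x0 xpi]; have [c /andP[c0 cx] ->] := sin_mvt x0.
rewrite mulrC ler_wpM2r //.
move: cx; rewrite le_eqVlt => /predU1P[->//|cx].
have xI : x \in `[0, pi] by rewrite in_itv /= x0 xpi.
have cI : c \in `[0, pi] by rewrite in_itv /= c0 (le_trans (ltW cx)).
by rewrite ltW // ltr_cos.
Qed.

(** Saves one cosine over the square of the previous bound. With [x = 2 h], that bound at [h] gives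
    [sin^2 x >= 4 h^2 cos^4 h], and [cos^4 h - cos (2 h) = (cos^2 h - 1)^2] is nonnegative. *)
Lemma sqr_mul_cos_le (R : realType) (x : R) : 0 <= x <= pi / 2 ->
  x ^+ 2 * cos x <= sin x ^+ 2.
Proof.
move=> /andP[x0 xpi]; pose h := x / 2.
have xE : x = h *+ 2 by rewrite /h -mulr_natr; field.
have h0 : 0 <= h by rewrite /h; lra.
have hpi : h <= pi by have := @pi_ge0 R; rewrite /h; lra.
have hc : 0 <= cos h.
  by apply: cos_ge0_pihalf; have := @pi_ge0 R; rewrite /h; lra.
have hs : (h * cos h) ^+ 2 <= sin h ^+ 2.
  by rewrite ler_pXn2r ?nnegrE ?mulr_ge0 ?sin_ge0_pi ?mul_cos_le_sin ?h0.
rewrite xE sin_mulr2n cos_mulr2n.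
apply: (@le_trans _ _ (4 * ((h * cos h) ^+ 2 * cos h ^+ 2))).
  rewrite -subr_ge0 (_ : _ - _ = 4 * (h ^+ 2 * (cos h ^+ 2 - 1) ^+ 2)); last by ring.
  by apply: mulr_ge0 => //; apply: mulr_ge0; exact: sqr_ge0.
rewrite (_ : (cos h * sin h *+ 2) ^+ 2 = 4 * (sin h ^+ 2 * cos h ^+ 2)); last by ring.
by rewrite ler_pM2l // ler_wpM2r ?sqr_ge0.
Qed.

(** * Cosine sums and the discrete cosine transform *)

(** Telescoping: [2 cos ((2 i + 1) x) sin x = sin ((2 i + 2) x) - sin (2 i x)]. *)
Lemma sum_cos_odd (R : realType) (p : nat) (x : R) :
  (\sum_(i < p) cos ((2 * i + 1)%:R * x)) * (2 * sin x) = sin ((2 * p)%:R * x).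
Proof.
elim: p => [|p IH]; first by rewrite big_ord0 muln0 !mul0r sin0.
rewrite big_ord_recr mulrDl IH /=.
have -> : (2 * p.+1)%:R * x = (2 * p + 1)%:R * x + x :> R.
  by rewrite mulnS !natrD; ring.
have -> : (2 * p)%:R * x = (2 * p + 1)%:R * x - x :> R by rewrite !natrD; ring.
by rewrite sinB sinD; ring.
Qed.

(* The eigenvectors of the Hankel matrix are those of the type-IV discrete cosine
   transform; dct is symmetric in j and s, so orthogonality of the eigenvectors is
   also completeness. *)
Definition dct_angle (R : realType) (n j : nat) : R := (2 * j + 1)%:R * (pi / (4 * n)%:R).

Definition dct (R : realType) (n j s : nat) : R := cos ((2 * s + 1)%:R * dct_angle R n j).

Lemma dctC (R : realType) (n j s : nat) : dct R n j s = dct R n s j.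
Proof. by rewrite /dct /dct_angle mulrCA. Qed.

Lemma dct_angle_range (R : realType) (n j : nat) : (j < n)%N ->
  0 < dct_angle R n j < pi / 2.
Proof.
move=> jn; have pi0 := @pi_gt0 R.
have n0 : (0 : R) < (4 * n)%:R by rewrite ltr0n; lia.
rewrite /dct_angle; apply/andP; split.
  by rewrite mulr_gt0 ?divr_gt0 // ltr0n; lia.
rewrite mulrA ltr_pdivrMr // mulrC -mulrA ltr_pM2l //.
have : ((2 * j + 1)%:R : R) < (2 * n)%:R by rewrite ltr_nat; lia.
by rewrite !natrM; lra.
Qed.

Lemma sin_natpi (R : realType) (k : nat) : sin (k%:R * pi) = 0 :> R.
Proof.
elim: k => [|k IH]; first by rewrite mul0r sin0.
by rewrite -natr1 mulrDl mul1r sinDpi IH oppr0.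
Qed.

Lemma cos_natpi (R : realType) (k : nat) : cos (k%:R * pi) = (-1) ^+ k :> R.
Proof.
elim: k => [|k IH]; first by rewrite mul0r cos0 expr0.
by rewrite -natr1 mulrDl mul1r cosDpi IH exprS mulN1r.
Qed.

(** The telescoped sum is [sin (q pi) = 0], while the range of [q] keeps the factor [sin x]
    positive. *)
Lemma sum_cos_odd_eq0 (R : realType) (n q : nat) : (0 < q < 2 * n)%N ->
  \sum_(j < n) cos ((2 * j + 1)%:R * (q%:R * (pi / (2 * n)%:R))) = 0 :> R.
Proof.
move=> qn; have pi0 := @pi_gt0 R; set x : R := q%:R * _.
have n0 : ((2 * n)%:R : R) != 0 by rewrite pnatr_eq0; lia.
have n0' : (0 : R) < (2 * n)%:R by rewrite ltr0n; lia.
have := sum_cos_odd n x.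
have -> : (2 * n)%:R * x = q%:R * pi by rewrite /x mulrCA [_%:R * (pi / _)]mulrC divfK.
rewrite sin_natpi => /eqP; rewrite mulf_eq0 => /orP[/eqP //|].
have : 0 < sin x.
  apply: sin_gt0_pi; rewrite /x; apply/andP; split.
    by rewrite mulr_gt0 ?divr_gt0 // ltr0n; lia.
  by rewrite mulrA ltr_pdivrMr // mulrC ltr_pM2l // ltr_nat; lia.
by move=> s0 /eqP h; exfalso; lra.
Qed.

(** Product to sum: the frequencies [s + t + 1] and [s - t] both give vanishing sums, except that
    [s - t = 0] contributes [n]. *)
Lemma dct_orthogonal (R : realType) (n s t : nat) : (s < n)%N -> (t < n)%N ->
  \sum_(j < n) dct R n j s * dct R n j t = (n%:R / 2) *+ (s == t).
Proof.
wlog st : s t / (t <= s)%N.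
  move=> h sn tn; case: (leqP t s) => st; first exact: h.
  under eq_bigr do rewrite mulrC.
  by rewrite (h t s (ltnW st) tn sn) eq_sym.
move=> sn tn.
have n0 : (n%:R : R) != 0 by rewrite pnatr_eq0; lia.
have stE : s%:R - t%:R = (s - t)%:R :> R by rewrite natrB.
have dE j : dct R n j s * dct R n j t =
    2^-1 * (cos ((2 * j + 1)%:R * ((s + t + 1)%:R * (pi / (2 * n)%:R))) +
            cos ((2 * j + 1)%:R * ((s - t)%:R * (pi / (2 * n)%:R)))).
  pose a := (2 * s + 1)%:R * dct_angle R n j; pose b := (2 * t + 1)%:R * dct_angle R n j.
  have -> : (2 * j + 1)%:R * ((s + t + 1)%:R * (pi / (2 * n)%:R)) = a + b.
    by rewrite /a /b /dct_angle !(natrM, natrD); field.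
  have -> : (2 * j + 1)%:R * ((s - t)%:R * (pi / (2 * n)%:R)) = a - b.
    by rewrite /a /b /dct_angle -stE !(natrM, natrD); field.
  by rewrite cosD cosB /dct -/a -/b; field.
under eq_bigr do rewrite dE.
rewrite -mulr_sumr big_split /= sum_cos_odd_eq0 ?add0r; last lia.
case: (eqVneq s t) => [->|nst].
  rewrite subnn; under eq_bigr do rewrite mul0r mulr0 cos0.
  by rewrite sumr_const card_ord mulr1n mulrC.
by rewrite sum_cos_odd_eq0 ?mulr0 //; lia.
Qed.

Lemma dct_top_angle (R : realType) (n j : nat) : (0 < n)%N ->
  (2 * n)%:R * dct_angle R n j = j%:R * pi + pi / 2.
Proof.
move=> n0; have n0' : (n%:R : R) != 0 by rewrite pnatr_eq0; lia.
by rewrite /dct_angle !(natrM, natrD); field.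
Qed.

Lemma sin_dct_top (R : realType) (n j : nat) : (0 < n)%N ->
  sin ((2 * n)%:R * dct_angle R n j) = (-1) ^+ j.
Proof. by move=> n0; rewrite dct_top_angle // sinDpihalf cos_natpi. Qed.

Lemma cos_dct_top (R : realType) (n j : nat) : (0 < n)%N ->
  cos ((2 * n)%:R * dct_angle R n j) = 0.
Proof. by move=> n0; rewrite dct_top_angle // cosDpihalf sin_natpi oppr0. Qed.

Definition hankel_eig (R : realType) (n j : nat) : R :=
  (-1) ^+ j * cos (dct_angle R n j) / (2 * sin (dct_angle R n j)).

Lemma sin_dct_gt0 (R : realType) (n j : nat) : (j < n)%N -> 0 < sin (dct_angle R n j).
Proof.
by move=> jn; apply: sin_gt0_pihalf; exact: dct_angle_range.
Qed.

Lemma sum_dct (R : realType) (n j : nat) : (j < n)%N ->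
  \sum_(s < n) dct R n j s = (-1) ^+ j / (2 * sin (dct_angle R n j)).
Proof.
move=> jn; have s0 := sin_dct_gt0 R jn.
apply: (mulIf (_ : 2 * sin (dct_angle R n j) != 0)); first by lra.
rewrite sum_cos_odd sin_dct_top; last lia.
by field; lra.
Qed.

Lemma sum_hankel_row (R : realFieldType) (n s : nat) (f : nat -> R) : (s < n)%N ->
  \sum_(i < n) hankel_coef R n s i * f i =
  \sum_(i < n.-1 - s) f i + 2^-1 * f (n.-1 - s)%N.
Proof.
move=> sn; rewrite -(big_mkord xpredT (fun i => hankel_coef R n s i * f i)).
rewrite (@big_cat_nat _ _ _ (n.-1 - s)) //=; last lia.
rewrite [X in _ + X](@big_cat_nat _ _ _ (n.-1 - s).+1) /=; [|lia..].
rewrite big_nat1 [X in _ + (_ + X)]big1_seq ?addr0; last first.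
  move=> i /andP[_]; rewrite mem_index_iota => h.
  by rewrite /hankel_coef ifF; [rewrite ifF ?mul0r //|]; lia.
congr (_ + _).
  rewrite big_mkord; apply: eq_bigr => i _; rewrite /hankel_coef ifT ?mul1r //.
  by have := ltn_ord i; lia.
by rewrite /hankel_coef ifF; [rewrite ifT //|]; lia.
Qed.

(** Put [p = n - 1 - s]. After multiplication by [2 sin a], the full terms give [sin (2 p a)] and
    the half term on the antidiagonal gives [cos ((2 p + 1) a) sin a]; together they are
    [sin ((2 p + 1) a) cos a]. As [(2 p + 1) a = 2 n a - (2 s + 1) a] and [cos (2 n a) = 0], the
    sine is [(-1)^j] times the eigenvector entry. *)
Lemma hankel_apply_dct (R : realType) (n j s : nat) : (j < n)%N -> (s < n)%N ->
  hankel_apply n (dct R n j) s = hankel_eig R n j * dct R n j s.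
Proof.
move=> jn sn; have s0 := sin_dct_gt0 R jn.
rewrite /hankel_apply sum_hankel_row //; set p := (n.-1 - s)%N.
set a := dct_angle R n j in s0 *.
apply: (mulIf (_ : 2 * sin a != 0)); first by lra.
rewrite mulrDl sum_cos_odd.
have -> : (2 * p)%:R * a = (2 * p + 1)%:R * a - a by rewrite natrD; ring.
have yE : (2 * p + 1)%:R * a = (2 * n)%:R * a - (2 * s + 1)%:R * a.
  rewrite -mulrBl -natrB; last lia.
  by congr (_ * _); congr GRing.natmul; rewrite /p; lia.
have yd : sin ((2 * p + 1)%:R * a) = (-1) ^+ j * dct R n j s.
  by rewrite yE sinB sin_dct_top ?cos_dct_top; [rewrite mul0r subr0|lia..].
rewrite sinB yd /hankel_eig -/a /dct -/a.
by field; lra.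
Qed.

(** Expansion of the all-ones vector in the eigenbasis: each coefficient is the sum of the
    eigenvector divided by its squared norm [n / 2]. *)
Lemma iter_hankel_one (R : realType) (n q s : nat) : (s < n)%N ->
  iter q (hankel_apply n) (fun=> 1) s =
  (2 / n%:R) * \sum_(j < n) ((-1) ^+ j / (2 * sin (dct_angle R n j))) *
     hankel_eig R n j ^+ q * dct R n j s.
Proof.
elim: q s => [|q IH] s sn.
  have n0 : (n%:R : R) != 0 by rewrite pnatr_eq0; lia.
  (* The entry 1 is written as a sum of Kronecker deltas, and each delta is expanded over the
     eigenvectors. *)
  rewrite /=; transitivity (\sum_(t < n) (1 : R) *+ (s == t)).
    rewrite (bigD1 (Ordinal sn)) //= eqxx big1 ?addr0 // => t ts.
    by rewrite (negbTE (_ : s != t)) //; apply: contra ts => /eqP st; apply/eqP/val_inj.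
  apply: (mulfI (_ : n%:R / 2 != 0 :> R)); first by rewrite mulf_neq0 ?invr_eq0.
  rewrite mulr_sumr.
  transitivity (\sum_(t < n) \sum_(j < n) dct R n j s * dct R n j t).
    by apply: eq_bigr => t _; rewrite dct_orthogonal // mulrnAr mulr1.
  rewrite exchange_big /= mulrA.
  have -> : n%:R / 2 * (2 / n%:R) = 1 :> R by field.
  rewrite mul1r; apply: eq_bigr => j _.
  by rewrite -mulr_sumr sum_dct // expr0 mulr1 mulrC.
rewrite iterS {1}/hankel_apply; under eq_bigr => t _ do rewrite IH // mulrCA mulr_sumr.
rewrite -mulr_sumr exchange_big /=; congr (_ * _); apply: eq_bigr => j _.
under eq_bigr do rewrite mulrCA.
rewrite -mulr_sumr -/(hankel_apply n (dct R n j) s) hankel_apply_dct //.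
by rewrite exprSr; ring.
Qed.

(** Parseval; the constants combine as [n (2 / n)^2 (n / 2) = 2], and squaring removes the signs. *)
Lemma iter_hankel_one_sqr_sum (R : realType) (n q : nat) : (0 < n)%N ->
  n%:R * \sum_(s < n) iter q (hankel_apply n) (fun=> 1 : R) s ^+ 2 =
  2 * \sum_(j < n) (hankel_eig R n j ^+ q / (2 * sin (dct_angle R n j))) ^+ 2.
Proof.
move=> n0; have n0' : (n%:R : R) != 0 by rewrite pnatr_eq0; lia.
under eq_bigr => s _ do rewrite iter_hankel_one // exprMn.
rewrite -mulr_sumr.
pose b j : R := ((-1) ^+ j / (2 * sin (dct_angle R n j))) * hankel_eig R n j ^+ q.
have -> : \sum_(s < n) (\sum_(j < n) b j * dct R n j s) ^+ 2 =
    \sum_(j < n) (n%:R / 2) * b j ^+ 2.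
  under eq_bigr => s _.
    rewrite expr2 mulr_suml.
    under eq_bigr => j _ do rewrite mulr_sumr.
    over.
  rewrite exchange_big /=; apply: eq_bigr => j _.
  rewrite exchange_big /= (bigD1 j) //= [X in _ + X]big1 => [|l lj].
    rewrite addr0 (eq_bigr (fun s : 'I_n => (b j ^+ 2) * (dct R n s j * dct R n s j))).
      by rewrite -mulr_sumr dct_orthogonal // eqxx mulr1n mulrC.
    by move=> s _; rewrite dctC; ring.
  rewrite (eq_bigr (fun s : 'I_n => (b j * b l) * (dct R n s j * dct R n s l))).
    rewrite -mulr_sumr dct_orthogonal // (negbTE (_ : val j != val l)) ?mulr0 //.
    by rewrite eq_sym.
  by move=> s _; rewrite ![dct R n _ s]dctC; ring.
rewrite -mulr_sumr !mulrA.
rewrite [LHS](_ : _ = 2 * \sum_(j < n) b j ^+ 2); last by field.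
congr (_ * _); apply: eq_bigr => j _.
by rewrite /b mulrAC -mulrA exprMn sqrr_sign mul1r.
Qed.

(** With [a] the angle, the right side is [(2 a)^(-4k)], so the claim is
    [a^(4k) cos^(4k-2) a <= sin^(4k) a]. Two cosines are missing for [a cos a <= sin a] alone;
    [a^2 cos a <= sin^2 a], used twice, makes up for them. *)
Lemma hankel_term_le (R : realType) (n j k : nat) : (0 < k)%N -> (j < n)%N ->
  (hankel_eig R n j ^+ (2 * k).-1 / (2 * sin (dct_angle R n j))) ^+ 2 <=
  (2 / ((2 * j%:R + 1) * pi)) ^+ (4 * k) * n%:R ^+ (4 * k).
Proof.
move=> k0 jn; have pi0 := @pi_gt0 R; have s0 := sin_dct_gt0 R jn.
have /andP[a0 api] := dct_angle_range R jn.
have api' : 0 <= dct_angle R n j <= pi by lra.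
have c0 : 0 <= cos (dct_angle R n j) by apply: cos_ge0_pihalf; lra.
rewrite -exprMn.
have -> : 2 / ((2 * j%:R + 1) * pi) * n%:R = (2 * dct_angle R n j)^-1.
  have n0 : (n%:R : R) != 0 by rewrite pnatr_eq0; lia.
  have j0 : (2 * j%:R + 1 : R) != 0 by rewrite -natrM natr1 pnatr_eq0.
  rewrite /dct_angle !(natrM, natrD).
  by move: (@pi R) (lt0r_neq0 pi0) => p p0; field; rewrite n0 j0 p0.
rewrite /hankel_eig; move: (dct_angle R n j) s0 a0 api api' c0 => a s0 a0 api api' c0.
have -> : (((-1) ^+ j * cos a / (2 * sin a)) ^+ (2 * k).-1 / (2 * sin a)) ^+ 2 =
   cos a ^+ (2 * (2 * k).-1) / (2 * sin a) ^+ (4 * k).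
  have -> : (4 * k = 2 * (2 * k).-1 + 2)%N by lia.
  move: (2 * k).-1 (2 * sin a) => q y.
  rewrite expr_div_n -exprM mulnC (exprM _ 2 q).
  have -> : ((-1) ^+ j * cos a / y) ^+ 2 = cos a ^+ 2 / y ^+ 2.
    by rewrite -mulrA exprMn sqrr_sign mul1r expr_div_n.
  by rewrite expr_div_n -!exprM -mulrA -invfM -exprD.
have p4 : (4 * k = 2 * 2 + 4 * k.-1)%N by lia.
rewrite exprVn ler_pdivrMr ?exprn_gt0 ?mulr_gt0 // mulrC.
have a20 : 0 < (2 * a) ^+ (4 * k) by rewrite exprn_gt0 // mulr_gt0.
rewrite ler_pdivlMr // (exprMn _ 2 a) (exprMn _ 2 (sin a)) mulrCA ler_pM2l ?exprn_gt0 //.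
have -> : (2 * (2 * k).-1 = 2 + 4 * k.-1)%N by lia.
rewrite p4; move: (4 * k.-1)%N => r; rewrite !exprD mulrACA -(exprMn r (cos a) a).
apply: ler_pM.
- by rewrite mulr_ge0 ?exprn_ge0 // ltW.
- by rewrite exprn_ge0 // mulr_ge0 // ltW.
- have a2 : 0 <= a <= pi / 2 by lra.
  have a3 := ltW a0; have s3 := ltW s0.
  rewrite !(exprM _ 2 2) -exprMn [_ * a ^+ 2]mulrC.
  by rewrite lerXn2r ?nnegrE ?sqr_mul_cos_le ?mulr_ge0 ?sqr_ge0.
- have ac0 : 0 <= a * cos a by rewrite mulr_ge0 // ltW.
  by rewrite mulrC lerXn2r ?nnegrE ?mul_cos_le_sin ?ac0 ?(ltW s0).
Qed.

(** * The bound on the trace of a power of [S] *)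

Lemma expmx_skew_apply (R : realFieldType) (n k : nat) (S : 'M[R]_n) (x a : 'I_n) :
  (S ^+ k.+1) x a = iter k (skew_apply S) (fun y => S y a) x.
Proof.
elim: k x => [|k IH] x; first by rewrite expr1.
by rewrite exprS mxE /= /skew_apply; apply: eq_bigr => y _; rewrite IH.
Qed.

Lemma trmx_exp (R : comPzRingType) (n k : nat) (A : 'M[R]_n) : (A ^+ k)^T = A^T ^+ k.
Proof.
elim: k => [|k IH]; first by rewrite !expr0 trmx1.
by rewrite exprSr [RHS]exprS [LHS]trmx_mul IH.
Qed.

Lemma pi_partial_sumE (R : realType) (l n : nat) :
  pi_partial_sum R l n = \sum_(j < n) (2 / ((2 * j%:R + 1) * pi)) ^+ l.
Proof.
rewrite /pi_partial_sum big_add1 big_mkord; apply: eq_bigr => j _.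
by congr ((2 / (_ * _)) ^+ _); rewrite -natr1; ring.
Qed.

Lemma pi_term_ge0 (R : realType) (j l : nat) :
  0 <= (2 / ((2 * j%:R + 1) * pi)) ^+ l :> R.
Proof.
apply: exprn_ge0; apply: divr_ge0 => //; apply: mulr_ge0; last exact: pi_ge0.
by rewrite -natrM natr1.
Qed.

(** [S^(2k)] is symmetric, so the trace of its square is the sum of its squared entries. Each of its
    [n] columns is obtained from a column of [S] by [2k - 1] applications of [S], and all of them
    obey the same Hankel bound. *)
Lemma trace_skew_exp_le (R : realType) (n k : nat) (S : 'M[R]_n) : (0 < k)%N ->
  S^T = - S -> (forall x y, `|S x y| <= 1) ->
  \tr (S ^+ (4 * k)) <= n%:R ^+ (4 * k) * (2 * pi_partial_sum R (4 * k) n).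
Proof.
move=> k0 skS S1; case: (posnP n) => [n0|n0].
  subst n; rewrite /mxtrace big_ord0 expr0n (_ : (4 * k == 0)%N = false) ?mul0r //.
  by lia.
have -> : (4 * k = 2 * k + 2 * k)%N by lia.
have symS : (S ^+ (2 * k))^T = S ^+ (2 * k) by rewrite trmx_exp skS !exprM sqrrN.
apply: (@le_trans _ _ (\sum_(a < n) \sum_(s < n) iter (2 * k).-1 (hankel_apply n) (fun=> 1 : R) s ^+ 2)).
  rewrite exprD /mxtrace; apply: ler_sum => a _; rewrite mxE.
  rewrite (eq_bigr (fun x => iter (2 * k).-1 (skew_apply S) (fun y => S y a) x ^+ 2)) => [|x _].
    by apply: iter_skew_sqr_sum_le => // x.
  rewrite -[in X in X * _]symS mxE -expmx_skew_apply expr2.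
  by have -> : (2 * k = (2 * k).-1.+1)%N by lia.
rewrite sumr_const card_ord -[leLHS]mulr_natl iter_hankel_one_sqr_sum // mulrCA ler_pM2l //.
rewrite pi_partial_sumE mulr_sumr; apply: ler_sum => j _.
have -> : (2 * k + 2 * k = 4 * k)%N by lia.
by rewrite [leRHS]mulrC hankel_term_le.
Qed.

(** * Directed cycles and closed walks *)

(** Cycles with a distinguished starting vertex, before passing to arc sets. *)
Definition cycle_tuples (T : finType) (D : {set T * T}) (l : nat) : {set l.-tuple T} :=
  [set c : l.-tuple T | uniq c && cycle (fun x y => (x, y) \in D) c].

Lemma next_nth_uniq (T : eqType) (x0 : T) (s : seq T) (k : nat) :
  uniq s -> (k.+1 < size s)%N -> next s (nth x0 s k) = nth x0 s k.+1.
Proof.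
move=> us ks; have kl : (k < size s)%N by lia.
rewrite next_nth mem_nth //; case: s us ks kl => [//|y s] us ks kl.
by rewrite index_uniq //= (set_nth_default x0).
Qed.

Lemma cycle_arcs_rot (T : finType) (s : seq T) (i : nat) :
  uniq s -> cycle_arcs (rot i s) = cycle_arcs s.
Proof.
by move=> us; apply/setP => a; rewrite !inE mem_rot next_rot.
Qed.

(** The arc set determines the successor of every vertex, so two sequences rotated to a common first
    vertex agree. *)
Lemma cycle_arcs_eq (T : finType) (s t : seq T) :
  uniq s -> uniq t -> size s = size t -> cycle_arcs s = cycle_arcs t ->
  exists2 i, (i <= size t)%N & s = rot i t.
Proof.
case: s => [|x s]; first by case: t => // _ _ _ _; exists 0%N.
move=> us ut st E.
have nE y : y \in x :: s -> y \in t /\ next (x :: s) y = next t y.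
  move=> ys; move/setP/(_ (y, next (x :: s) y)): E.
  by rewrite /cycle_arcs 2!finset.in_set /= ys eqxx => /esym/andP[-> /eqP].
have [xt _] := nE x (mem_head _ _).
have [i t' Et] := rot_to xt.
(* [rot_to] gives no bound on [i]; rotating by more than the length is the identity. *)
exists (minn i (size t)); first exact: geq_minr.
have -> : rot (minn i (size t)) t = rot i t.
  case: (leqP i (size t)) => [//|ti].
  by rewrite rot_size rot_oversize // ltnW.
apply: (@eq_from_nth _ x); first by rewrite size_rot.
have ur : uniq (rot i t) by rewrite rot_uniq.
elim=> [|k IH] ks; first by rewrite Et.
have ks' : (k < size (x :: s))%N by lia.
rewrite -next_nth_uniq // -[RHS]next_nth_uniq ?size_rot -?st //.
by rewrite -IH // next_rot //; case: (nE _ (mem_nth x ks')).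
Qed.

(** The fibres of [cycle_arcs] are the rotation classes; the [l] rotations of a uniq tuple differ in
    their first vertex. *)
Lemma card_cycle_tuples (T : finType) (D : {set T * T}) (l : nat) : (0 < l)%N ->
  #|cycle_tuples D l| = (l * #|dicycles D l|)%N.
Proof.
move=> l0; rewrite -sum1_card (partition_big_imset (fun c : l.-tuple T => cycle_arcs c)) /=.
rewrite (_ : (fun c : l.-tuple T => cycle_arcs c) @: cycle_tuples D l = dicycles D l);
  last by apply/setP => a; apply/imsetP/imsetP => -[c cA ->]; exists c; rewrite ?inE // in cA *.
rewrite mulnC -sum_nat_const; apply: eq_bigr => a /imsetP[c]; rewrite inE => /andP[uc cc] ->.
rewrite sum1_card -[RHS]card_ord.
have injr : injective (fun i : 'I_l => rot_tuple i c).
  move=> i j /(congr1 val) /= ij; apply/val_inj/eqP => /=.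
  have x0 : T by case: l l0 c {uc cc i j ij} => // l' _ c; exact: thead c.
  have h k : (k < l)%N -> nth x0 (rot k c) 0 = nth x0 c k.
    by move=> kl; rewrite /rot nth_cat size_drop size_tuple subn_gt0 kl nth_drop addn0.
  by rewrite -(nth_uniq x0 _ _ uc) ?size_tuple // -!h // ij.
rewrite -(card_imset _ injr); apply: eq_card => d.
rewrite [LHS]unfold_in inE; apply/idP/imsetP => [/andP[/andP[ud cd] /eqP dE]|[i _ ->]].
  have [|i il dr] := cycle_arcs_eq ud uc _ dE; first by rewrite !size_tuple.
  rewrite size_tuple leq_eqVlt in il; case/predU1P: il => [il|il].
    exists (Ordinal l0) => //; apply: val_inj.
    by rewrite /= dr il -[X in rot X](size_tuple c) rot_size rot0.
  by exists (Ordinal il) => //; apply: val_inj.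
by rewrite rot_uniq uc rot_cycle cc cycle_arcs_rot ?eqxx.
Qed.

(** * Traces as weighted counts of closed walks *)

Fixpoint walk_prod (R : nzRingType) (n : nat) (B : 'M[R]_n) (x : 'I_n) (s : seq 'I_n) : R :=
  if s is y :: s' then B x y * walk_prod B y s' else 1.

Lemma sum_tuple_cons (R : nmodType) (T : finType) (l : nat) (F : l.+1.-tuple T -> R) :
  \sum_s F s = \sum_y \sum_(t : l.-tuple T) F (cons_tuple y t).
Proof.
rewrite pair_bigA /= (reindex (fun p : T * l.-tuple T => cons_tuple p.1 p.2)) //=.
exists (fun s => (thead s, behead_tuple s)) => [[y t] _|s _].
  by rewrite theadE; congr (_, _); apply: val_inj.
by rewrite [in RHS](tuple_eta s).
Qed.

Lemma expmx_walk (R : nzRingType) (n l : nat) (B : 'M[R]_n) (x y : 'I_n) :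
  (B ^+ l) x y = \sum_(s : l.-tuple 'I_n | last x s == y) walk_prod B x s.
Proof.
elim: l x => [|l IH] x.
  rewrite expr0 mxE big_mkcond (eq_bigr (fun=> (x == y)%:R)) => [|s _].
    by rewrite sumr_const card_tuple expn0 mulr1n.
  by rewrite tuple0 /=; case: eqP.
rewrite exprS mxE [RHS]big_mkcond [RHS]sum_tuple_cons; apply: eq_bigr => z _.
rewrite IH mulr_sumr big_mkcond; apply: eq_bigr => t _ /=.
by case: eqP.
Qed.

(** A closed walk is encoded by the vertices after its start, which is the last of them; the tuple
    is nonempty, so the default [ord0] never shows. *)
Lemma trace_walk (R : nzRingType) (n l : nat) (B : 'M[R]_n.+1) :
  \tr (B ^+ l.+1) = \sum_(s : l.+1.-tuple 'I_n.+1) walk_prod B (last ord0 s) s.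
Proof.
rewrite /mxtrace; under eq_bigr => x _ do rewrite expmx_walk big_mkcond.
rewrite exchange_big; apply: eq_bigr => s _ /=.
have lE x : last x s = last ord0 s by rewrite (tuple_eta s).
rewrite (bigD1 (last ord0 s)) //= lE eqxx big1 ?addr0 // => x xs.
by rewrite lE eq_sym (negbTE xs).
Qed.

Definition arc_mx (R : nzRingType) (n : nat) (D : {set 'I_n * 'I_n}) : 'M[R]_n :=
  \matrix_(x, y) (((x, y) \in D)%:R - ((y, x) \in D)%:R).

Lemma arc_mx_skew (R : nzRingType) (n : nat) (D : {set 'I_n * 'I_n}) :
  (arc_mx R D)^T = - arc_mx R D.
Proof. by apply/matrixP => x y; rewrite !mxE opprB. Qed.

Lemma arc_mx_le1 (R : realDomainType) (n : nat) (D : {set 'I_n * 'I_n}) x y :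
  `|arc_mx R D x y| <= 1.
Proof.
rewrite mxE; do 2!case: (_ \in D); rewrite ?subrr ?subr0 ?sub0r ?normr0 ?normrN1 ?normr1 //.
Qed.

Lemma arc_mxD1E (R : nzRingType) (n : nat) (D : {set 'I_n * 'I_n}) x y : tournament D ->
  (arc_mx R D + const_mx 1) x y = 2 * ((x, y) \in D)%:R + (x == y)%:R.
Proof.
move=> /andP[/forallP irr /forallP tot]; rewrite !mxE.
case: (eqVneq x y) => [->|xy]; first by rewrite (negbTE (irr y)) subrr mulr0.
have /forallP/(_ y)/implyP/(_ xy) := tot x.
by case: (_ \in D); case: (_ \in D) => //= _; rewrite ?subr0 ?sub0r ?mulr0 ?mulr1 ?addNr ?addr0.
Qed.

(** Here [B] is twice the adjacency matrix plus the identity: its entries lie between 0 and 2, and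
    off the diagonal they are 2 on arcs and 0 elsewhere. *)
Lemma walk_prod_bounds (R : numDomainType) (n : nat) (D : {set 'I_n * 'I_n}) x s :
  tournament D -> let B := arc_mx R D + const_mx 1 in
  0 <= walk_prod B x s <= 2 ^+ size s /\
  (path (fun x y => x != y) x s ->
   walk_prod B x s = 2 ^+ size s *+ path (fun x y => (x, y) \in D) x s).
Proof.
move=> tD B; elim: s x => [|y s IH] x /=; first by rewrite expr0 ler01 lexx.
have [/andP[h1 h2] h3] := IH y.
have Bge : 0 <= B x y <= 2.
  rewrite arc_mxD1E //; case: (eqVneq x y) => [->|_].
    by have /andP[/forallP/(_ y)/negbTE -> _] := tD; rewrite mulr0 add0r ler01 ler1n.
  by rewrite addr0; case: (_ \in D); rewrite ?mulr0 ?mulr1 ?lexx ?ler0n.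
have /andP[B0 B2] := Bge.
split; first by rewrite mulr_ge0 //= exprS ler_pM.
move=> /andP[xy ps]; rewrite h3 // arc_mxD1E // (negbTE xy) addr0.
by case: (_ \in D) => /=; rewrite ?mulr0 ?mul0r ?mulr1 // mulrnAr exprS.
Qed.

Lemma uniq_cycle_neq (T : eqType) (s : seq T) :
  (1 < size s)%N -> uniq s -> cycle (fun x y => x != y) s.
Proof.
have uP x (t : seq T) : uniq (x :: t) -> path (fun x y => x != y) x t.
  elim: t x => //= y t IH x /andP[]; rewrite inE negb_or => /andP[xy _] ut.
  by rewrite xy IH.
case: s => [//|x [//|y s]] _ us; rewrite (cycle_path x).
move: (us); rewrite lastI rcons_uniq -lastI /=.
rewrite -/(path (fun x y => x != y) x (y :: s)) => h.
apply/andP; split; last exact: (uP x (y :: s)).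
move: us; rewrite cons_uniq => /andP[+ _]; apply: contra => /eqP <-.
exact: mem_last.
Qed.

(** Closed walks without repeated vertices weigh [2^l] on directed cycles and 0 otherwise; each of
    the [n^l - n^_l] others weighs between 0 and [2^l]. *)
Lemma trace_cycle_bounds (R : numDomainType) (n l : nat) (D : {set 'I_n * 'I_n}) :
  (1 < l)%N -> tournament D ->
  2 ^+ l * (l * #|dicycles D l|)%:R <= \tr ((arc_mx R D + const_mx 1) ^+ l) <=
  2 ^+ l * (l * #|dicycles D l|)%:R + 2 ^+ l * (n ^ l - n ^_ l)%:R.
Proof.
case: l => [//|l] l1; rewrite -card_cycle_tuples //; case: n D => [|n] D tD.
  rewrite /mxtrace big_ord0.
  have -> : #|cycle_tuples D l.+1| = 0%N by apply: eq_card0 => c; have := thead c; case.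
  by rewrite mulr0 lexx add0r mulr_ge0 ?exprn_ge0.
have tE : \tr ((arc_mx R D + const_mx 1) ^+ l.+1) =
    \sum_(s : l.+1.-tuple 'I_n.+1) walk_prod (arc_mx R D + const_mx 1) (last ord0 s) s.
  exact: trace_walk.
have cE (A : {set l.+1.-tuple 'I_n.+1}) : 2 ^+ l.+1 * #|A|%:R = \sum_s (2 ^+ l.+1 : R) *+ (s \in A).
  rewrite -sum1_card natr_sum mulr_sumr big_mkcond; apply: eq_bigr => s _.
  by case: (s \in A); rewrite ?mulr1.
have bE (s : l.+1.-tuple 'I_n.+1) : uniq s ->
    walk_prod (arc_mx R D + const_mx 1) (last ord0 s) s = 2 ^+ l.+1 *+ (s \in cycle_tuples D l.+1).
  move=> us; have [_ ->] := walk_prod_bounds R (last ord0 s) s tD.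
    by rewrite size_tuple inE us (cycle_path ord0).
  by rewrite -cycle_path uniq_cycle_neq // size_tuple.
rewrite tE; apply/andP; split.
  rewrite cE; apply: ler_sum => s _; case: (boolP (uniq s)) => us; first by rewrite bE.
  rewrite inE (negbTE us) mulr0n.
  by have [/andP[]] := walk_prod_bounds R (last ord0 s) s tD.
pose N := [set s : l.+1.-tuple 'I_n.+1 | ~~ uniq s].
have -> : (n.+1 ^ l.+1 - n.+1 ^_ l.+1 = #|N|)%N.
  have -> : N = ~: [set s : l.+1.-tuple 'I_n.+1 | uniq s] by apply/setP => s; rewrite !inE.
  rewrite cardsCs finset.setCK card_tuple card_ord; congr (_ - _)%N.
  rewrite -[n.+1 in LHS]card_ord -(card_uniq_tuples l.+1 predT).
  by apply: eq_card => s; rewrite !inE all_predT.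
rewrite !cE -big_split; apply: ler_sum => s _ /=; case: (boolP (uniq s)) => us.
  by rewrite bE // lerDl mulrn_wge0 ?exprn_ge0.
rewrite !inE us (negbTE us) add0r mulr1n.
by have [/andP[_]] := walk_prod_bounds R (last ord0 s) s tD; rewrite size_tuple.
Qed.

(** * Traces of powers for the carousel *)

(** No error term appears: walks with repetitions can only increase the trace. *)
Lemma dicycles_le (R : realType) (n k : nat) (D : {set 'I_n * 'I_n}) :
  (0 < k)%N -> tournament D ->
  2 ^+ (4 * k) * (4 * k * #|dicycles D (4 * k)|)%:R <=
  n%:R ^+ (4 * k) * (1 + 2 * pi_partial_sum R (4 * k) n).
Proof.
move=> k0 tD; have l1 : (1 < 4 * k)%N by lia.
have /andP[h _] := trace_cycle_bounds R l1 tD.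
apply: le_trans h _; rewrite mulrDr mulr1.
apply: le_trans (trace_skewD1_exp_le_real k0 (arc_mx_skew R D) (arc_mx_le1 R D)) _.
by rewrite lerD2l trace_skew_exp_le ?arc_mx_skew //; exact: arc_mx_le1.
Qed.

(** * Carousels of odd order *)

Lemma odd_carouselE (m : nat) (x y : 'I_m.+1) :
  ((x, y) \in odd_carousel m) = (1 <= (y - x)%R <= m./2)%N.
Proof. by rewrite /odd_carousel finset.in_set. Qed.

(** For even [m], exactly one of [d] and [m.+1 - d] lies between 1 and [m./2]. *)
Lemma odd_carousel_tournament (m : nat) : ~~ odd m -> tournament (odd_carousel m).
Proof.
move=> em; apply/andP; split; first by apply/forallP => x; rewrite odd_carouselE subrr.
apply/forallP => x; apply/forallP => y; apply/implyP => xy.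
rewrite !odd_carouselE -[x - y]opprB.
have : y - x != 0 by rewrite subr_eq0 eq_sym.
move: (y - x) => d; rewrite -val_eqE /= => d0.
have dm := ltn_ord d.
have hm : m = (m./2).*2 by rewrite -[LHS]odd_double_half (negbTE em).
have dE : ((m.+1 - d) %% m.+1 = m.+1 - d)%N by rewrite modn_small //; lia.
rewrite dE {dE}; move: hm d0 dm; rewrite -muln2; move: (m./2) (nat_of_ord d) => h e; lia.
Qed.

(** Circulant structure: substituting [z = x + d], the wraparound modulo [m.+1] is absorbed by the
    period of [F]. It serves for cosine, sine and the constant function. *)
Lemma sum_arc_mx_odd_carousel (R : realType) (m : nat) (F : R -> R) (t : R) (x : 'I_m.+1) (y : R) :
  ~~ odd m -> (forall a, F (a + t * m.+1%:R) = F a) ->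
  \sum_z arc_mx R (odd_carousel m) x z * F (t * (z%:R - y)) =
  \sum_(d < m./2) (F (t * (x%:R - y) + t * d.+1%:R) - F (t * (x%:R - y) - t * d.+1%:R)).
Proof.
move=> em Fper.
have hm : m = (m./2).*2 by rewrite -[LHS]odd_double_half (negbTE em).
pose in_arc (d : 'I_m.+1) := (1 <= d <= m./2)%N.
have FN a : F (a - t * m.+1%:R) = F a by rewrite -{2}(subrK (t * m.+1%:R) a) Fper.
have sumE (G : R -> R) : \sum_(d : 'I_m.+1 | in_arc d) G d%:R = \sum_(d < m./2) G d.+1%:R.
  rewrite -(big_mkord xpredT (fun d => G d.+1%:R)).
  transitivity (\sum_(1 <= d < m./2.+1) G d%:R); last by rewrite big_add1.
  rewrite (big_nat_widenl 1 0) // (big_nat_widen _ _ m.+1) ?big_mkord; last by move: hm; lia.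
  by apply: eq_bigl => d; rewrite /in_arc /= ltnS.
rewrite (reindex (fun z => x + z)) /=; last first.
  by exists (fun z => z - x) => z _; rewrite ?(addrC x) ?addrK ?subrK.
have FE (z : 'I_m.+1) : F (t * ((x + z)%R%:R - y)) = F (t * (x%:R - y) + t * z%:R).
  have -> : ((x + z)%R : nat) = ((x + z) %% m.+1)%N by [].
  have xm := ltn_ord x; have zm := ltn_ord z.
  case: (ltnP (x + z) m.+1) => h; first by rewrite modn_small // natrD; congr F; ring.
  rewrite -[in LHS](subnK h) modnDr modn_small; last by lia.
  by rewrite natrB // natrD -[RHS]FN; congr F; ring.
have aE (z : 'I_m.+1) : arc_mx R (odd_carousel m) x (x + z) = (in_arc z)%:R - (in_arc (- z))%:R.
  rewrite mxE !odd_carouselE.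
  by rewrite addrAC subrr add0r opprD addrA subrr add0r.
under eq_bigr => z _ do rewrite FE aE mulrBl.
rewrite sumrB [in RHS]sumrB; congr (_ - _).
  rewrite -(sumE (fun d => F (t * (x%:R - y) + t * d))) [RHS]big_mkcond; apply: eq_bigr => z _.
  by case: (in_arc z); rewrite ?mul1r ?mul0r.
rewrite (reindex_inj oppr_inj).
rewrite -(sumE (fun d => F (t * (x%:R - y) - t * d))) [RHS]big_mkcond; apply: eq_bigr => z _.
rewrite opprK; case: ifP => [/andP[z0 _]|_]; rewrite ?mul1r ?mul0r //.
have -> : ((- z)%R : nat) = (m.+1 - z)%N by rewrite /= modn_small //; lia.
have zm := ltn_ord z.
by rewrite natrB ?(ltnW zm) // -[RHS]Fper; congr F; ring.
Qed.

(* As m.+1 is odd, the odd multiples of 2 pi / m.+1 represent all frequencies. *)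
Definition carousel_freq (R : realType) (m j : nat) : R :=
  (2 * j + 1)%:R * (2 * pi / m.+1%:R).

(** The carousel matrix multiplies the character of this frequency by [i] times this real number. *)
Definition carousel_eig (R : realType) (m j : nat) : R :=
  2 * \sum_(d < m./2) sin (carousel_freq R m j * d.+1%:R).

(** With [sin_mx], the real and imaginary parts of the rank-one matrix with entries
    [exp (i f (x - y))]; they keep the spectral argument over the reals. *)
Definition cos_mx (R : realType) (m j : nat) : 'M[R]_m.+1 :=
  \matrix_(x, y) cos (carousel_freq R m j * (x%:R - y%:R)).

Definition sin_mx (R : realType) (m j : nat) : 'M[R]_m.+1 :=
  \matrix_(x, y) sin (carousel_freq R m j * (x%:R - y%:R)).

Lemma carousel_freq_period (R : realType) (m j : nat) :
  carousel_freq R m j * m.+1%:R = (pi *+ 2) *+ (2 * j + 1).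
Proof.
rewrite /carousel_freq -mulrA divfK ?pnatr_eq0 // -[RHS]mulr_natl.
by rewrite mulr2n; ring.
Qed.

Lemma arc_mx_cos_mx (R : realType) (m j : nat) : ~~ odd m ->
  arc_mx R (odd_carousel m) *m cos_mx R m j = - carousel_eig R m j *: sin_mx R m j.
Proof.
move=> em; apply/matrixP => x y; rewrite !mxE.
under eq_bigr => z _ do rewrite [cos_mx R m j z y]mxE.
rewrite (@sum_arc_mx_odd_carousel R m cos); first last.
- by move=> a; rewrite carousel_freq_period periodicn //; exact: cosD2pi.
- by [].
rewrite /carousel_eig mulr_sumr -sumrN mulr_suml; apply: eq_bigr => d _.
by rewrite cosD cosB; ring.
Qed.

Lemma arc_mx_sin_mx (R : realType) (m j : nat) : ~~ odd m ->
  arc_mx R (odd_carousel m) *m sin_mx R m j = carousel_eig R m j *: cos_mx R m j.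
Proof.
move=> em; apply/matrixP => x y; rewrite !mxE.
under eq_bigr => z _ do rewrite [sin_mx R m j z y]mxE.
rewrite (@sum_arc_mx_odd_carousel R m sin); first last.
- by move=> a; rewrite carousel_freq_period periodicn //; exact: sinD2pi.
- by [].
rewrite /carousel_eig mulr_sumr mulr_suml; apply: eq_bigr => d _.
by rewrite sinD sinB; ring.
Qed.

Lemma arc_mx_const_mx (R : realType) (m : nat) : ~~ odd m ->
  arc_mx R (odd_carousel m) *m const_mx 1 = 0 :> 'M[R]_m.+1.
Proof.
move=> em; apply/matrixP => x y; rewrite !mxE.
under eq_bigr => z _ do rewrite [const_mx 1 z y]mxE.
rewrite (@sum_arc_mx_odd_carousel R m (fun=> 1) 0 x 0) //.
by rewrite big1 // => d _; rewrite subrr.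
Qed.

Lemma sin_neq0 (R : realType) (x : R) : 0 < x < 2 * pi -> x != pi -> sin x != 0.
Proof.
move=> /andP[x0 x2] xpi; case: (ltgtP x pi) => h.
- by rewrite gt_eqF // sin_gt0_pi // x0.
- have : 0 < sin (x - pi) by apply: sin_gt0_pi; lra.
  rewrite -[x in sin x != 0](subrK pi) sinDpi oppr_eq0 => h0.
  by rewrite gt_eqF.
- by rewrite h eqxx in xpi.
Qed.

(** Resolution of the identity. Off the diagonal the telescoped sum is [sin (4 pi d) = 0]; the
    factor [sin (2 pi d / m.+1)] is nonzero since [2 d = m.+1] is excluded by parity. *)
Lemma sum_cos_mx (R : realType) (m : nat) : ~~ odd m ->
  \sum_(j < m.+1) cos_mx R m j = m.+1%:R%:M.
Proof.
move=> em; apply/matrixP => x y; rewrite summxE !mxE.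
have m0 : (m.+1%:R : R) != 0 by rewrite pnatr_eq0.
have pi0 := @pi_gt0 R.
pose X (d : nat) : R := 2 * pi / m.+1%:R * d%:R.
have zero d : (0 < d < m.+1)%N -> \sum_(j < m.+1) cos ((2 * j + 1)%:R * X d) = 0.
  move=> dm; have := sum_cos_odd m.+1 (X d).
  have -> : (2 * m.+1)%:R * X d = 0 + (pi *+ 2) *+ (2 * d).
    rewrite add0r /X -[RHS]mulr_natr -[pi *+ 2]mulr_natl !natrM.
    by move: (@pi R) (m.+1%:R : R) m0 => p N N0; field.
  rewrite periodicn; last exact: sinD2pi.
  rewrite sin0 => /eqP; rewrite mulf_eq0 => /orP[/eqP //|].
  have m0' : (0 : R) < m.+1%:R by rewrite ltr0n.
  rewrite mulf_eq0 pnatr_eq0 /= => h; exfalso; move: h; apply/negP.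
  apply: sin_neq0.
    rewrite /X; apply/andP; split; first by rewrite !mulr_gt0 ?invr_gt0 // ltr0n; lia.
    rewrite mulrAC ltr_pdivrMr // ltr_pM2l ?mulr_gt0 // ltr_nat; lia.
  apply: contraNneq (_ : ~~ (2 * d == m.+1)%N) => [E|]; last by move: em; lia.
  rewrite -(eqr_nat R) natrM; apply/eqP.
  apply: (mulfI (lt0r_neq0 pi0)); apply: (mulIf (_ : (m.+1%:R : R)^-1 != 0)); first by rewrite invr_eq0.
  by rewrite mulfK // -[RHS]E /X; ring.
have cE (a b : 'I_m.+1) j : cos_mx R m j a b = cos ((2 * j + 1)%:R * (2 * pi / m.+1%:R * (a%:R - b%:R))).
  by rewrite mxE /carousel_freq !mulrA.
case: (ssrnat.ltngtP x y) => xy.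
- have -> : (x == y) = false by apply/eqP => E; rewrite E ltnn in xy.
  rewrite mulr0n.
  rewrite -[RHS](zero (y - x)%N); last by have := ltn_ord y; lia.
  apply: eq_bigr => j _; rewrite cE -cosN; congr cos.
  by rewrite /X natrB ?(ltnW xy) //; ring.
- have -> : (x == y) = false by apply/eqP => E; rewrite E ltnn in xy.
  rewrite mulr0n.
  rewrite -[RHS](zero (x - y)%N); last by have := ltn_ord x; lia.
  apply: eq_bigr => j _; rewrite cE; congr cos.
  by rewrite /X natrB ?(ltnW xy).
- have -> : x = y by apply: val_inj.
  rewrite eqxx mulr1n (eq_bigr (fun=> 1)) => [|j _]; last by rewrite cE subrr !mulr0 cos0.
  by rewrite sumr_const card_ord.
Qed.

(** [S^2] acts on each [cos_mx] as a scalar; the trace of [S^(4k)] times the resolution of the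
    identity is then read off term by term. *)
Lemma trace_odd_carousel_exp (R : realType) (m k : nat) : ~~ odd m ->
  \tr (arc_mx R (odd_carousel m) ^+ (4 * k)) = \sum_(j < m.+1) carousel_eig R m j ^+ (4 * k).
Proof.
move=> em; set S := arc_mx R _.
have m0 : (m.+1%:R : R) != 0 by rewrite pnatr_eq0.
have S2K j : S ^+ 2 *m cos_mx R m j = (- carousel_eig R m j ^+ 2) *: cos_mx R m j.
  rewrite (_ : S ^+ 2 = S *m S) // -mulmxA arc_mx_cos_mx // -scalemxAr.
  by rewrite arc_mx_sin_mx // scalerA mulNr expr2.
have SK j q : S ^+ (2 * q) *m cos_mx R m j = (- carousel_eig R m j ^+ 2) ^+ q *: cos_mx R m j.
  elim: q => [|q IH]; first by rewrite muln0 !expr0 mul1mx scale1r.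
  rewrite (_ : S ^+ (2 * q.+1) = S ^+ (2 * q) *m S ^+ 2).
    by rewrite -mulmxA S2K -scalemxAr IH scalerA -exprS.
  by rewrite mulnSr exprD.
apply: (mulfI m0).
have <- : \tr (S ^+ (4 * k) *m m.+1%:R%:M) = m.+1%:R * \tr (S ^+ (4 * k)).
  by rewrite mul_mx_scalar mxtraceZ.
rewrite -sum_cos_mx // mulmx_sumr raddf_sum /= mulr_sumr; apply: eq_bigr => j _.
have -> : (4 * k = 2 * (2 * k))%N by lia.
rewrite SK mxtraceZ exprM sqrrN -!exprM mulrC; congr (_ * _).
  rewrite /mxtrace (eq_bigr (fun=> 1)) => [|x _]; last by rewrite mxE subrr mulr0 cos0.
  by rewrite sumr_const card_ord.
Qed.

(** Since [S J = J S = 0], all mixed terms of the power vanish, and [J^q] is [m.+1^(q-1)] times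
    [J]. *)
Lemma trace_odd_carouselD1_exp (R : realType) (m k : nat) : ~~ odd m -> (0 < k)%N ->
  \tr ((arc_mx R (odd_carousel m) + const_mx 1) ^+ (4 * k)) =
  m.+1%:R ^+ (4 * k) + \tr (arc_mx R (odd_carousel m) ^+ (4 * k)).
Proof.
move=> em k0; set S := arc_mx R _; set J : 'M[R]_m.+1 := const_mx 1.
have SJ : S * J = 0 by exact: arc_mx_const_mx.
have JS : J * S = 0.
  have := congr1 trmx SJ; rewrite /GRing.mul /= trmx_mul trmx0 arc_mx_skew trmx_const mulmxN.
  by move=> /eqP; rewrite oppr_eq0 => /eqP.
have SnJ q : S ^+ q.+1 * J = 0 by rewrite exprSr -mulrA SJ mulr0.
have pE q : (S + J) ^+ q.+1 = S ^+ q.+1 + J ^+ q.+1.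
  elim: q => [|q IH]; first by rewrite !expr1.
  rewrite exprSr IH mulrDl !mulrDr SnJ -exprSr addr0.
  by rewrite [J ^+ q.+1]exprSr -mulrA JS mulr0 add0r -!exprSr.
have JJ : J * J = m.+1%:R *: J.
  apply/matrixP => x y; rewrite !mxE mulr1 (eq_bigr (fun=> 1)) => [|z _]; last by rewrite !mxE mulr1.
  by rewrite sumr_const card_ord.
have Jn q : J ^+ q.+1 = m.+1%:R ^+ q *: J.
  elim: q => [|q IH]; first by rewrite expr1 expr0 scale1r.
  by rewrite exprSr IH -scalerAl JJ scalerA -exprSr.
have -> : (4 * k = (4 * k).-1.+1)%N by lia.
rewrite pE Jn raddfD /= addrC mxtraceZ [m.+1%:R ^+ _.+1]exprSr; congr (_ * _ + _).
rewrite /mxtrace (eq_bigr (fun=> 1)) => [|x _]; last by rewrite mxE.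
by rewrite sumr_const card_ord.
Qed.

(** The eigenvalue is [cot a], where [a] is a quarter of the frequency; then [cos a >= 1 - a^2 / 2]
    and [sin a <= a]. *)
Lemma carousel_eig_ge (R : realType) (m j : nat) (a : R) : ~~ odd m ->
  a = (2 * j + 1)%:R * pi / (2 * m.+1%:R) -> a <= 1 ->
  (1 - a ^+ 2) / a <= carousel_eig R m j.
Proof.
move=> em aE a1; have pi0 := @pi_gt0 R; have pi2 := @pi_ge2 R.
have m0 : (m.+1%:R : R) != 0 by rewrite pnatr_eq0.
have a0 : 0 < a by rewrite aE divr_gt0 ?mulr_gt0 // ltr0n; lia.
have fE : carousel_freq R m j = 4 * a.
  rewrite /carousel_freq aE.
  by move: (@pi R) (m.+1%:R : R) m0 => p N N0; field.
have closed h : (\sum_(d < h) sin (4 * a * d.+1%:R)) * (2 * sin (2 * a)) =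
    cos (2 * a) - cos ((2 * h + 1)%:R * (2 * a)).
  elim: h => [|h IH]; first by rewrite big_ord0 mul0r muln0 add0n mul1r subrr.
  rewrite big_ord_recr mulrDl IH /=.
  have -> : (2 * h + 1)%:R * (2 * a) = 4 * a * h.+1%:R - 2 * a.
    by rewrite -natr1 natrD natrM; ring.
  have -> : (2 * h.+1 + 1)%:R * (2 * a) = 4 * a * h.+1%:R + 2 * a.
    by rewrite -natr1 natrD natrM -natr1; ring.
  by rewrite cosB cosD; ring.
have hm : m = (m./2).*2 by rewrite -[LHS]odd_double_half (negbTE em).
(* Strictness puts [a <= 1] below [pi / 2]; equality would make [cos 1] vanish. *)
have pi2' : 2 < pi :> R.
  rewrite lt_neqAle pi2 andbT; apply/eqP => E; have := @cos1_gt0 R.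
  by rewrite (_ : 1 = pi / 2) ?cos_pihalf ?ltxx // -E; field.
have c0 : 0 < cos a by apply: cos_gt0_pihalf; lra.
have s0 : 0 < sin a by apply: sin_gt0_pihalf; lra.
have top : cos ((2 * m./2 + 1)%:R * (2 * a)) = -1.
  have -> : (2 * m./2 + 1 = m.+1)%N by rewrite mul2n -hm addn1.
  have -> : m.+1%:R * (2 * a) = (2 * j + 1)%:R * pi.
    rewrite aE; move: (@pi R) (m.+1%:R : R) m0 => p N N0; field; exact: N0.
  by rewrite cos_natpi -signr_odd oddD oddM /= expr1.
have E : carousel_eig R m j = cos a / sin a.
  have := closed m./2; rewrite top /carousel_eig fE.
  have -> : 2 * a = a *+ 2 by rewrite mulr_natl.
  rewrite sin_mulr2n cos_mulr2n => h.
  apply: (mulIf (_ : 2 * (cos a * sin a) != 0)); first by rewrite !mulf_neq0 ?gt_eqF.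
  transitivity (2 * cos a ^+ 2); last by field; rewrite gt_eqF.
  move: h; set Z := \sum_(d < _) _ => h.
  have -> : 2 * Z * (2 * (cos a * sin a)) = Z * (2 * (cos a * sin a *+ 2)) by rewrite mulr2n; ring.
  by rewrite h mulr2n; ring.
rewrite E ler_pdivrMr // mulrAC ler_pdivlMr //.
have sa := sin_le_id (ltW a0).
have ca : 1 - a ^+ 2 / 2 <= cos a.
  have -> : cos a = 1 - 2 * sin (a / 2) ^+ 2.
    have -> : cos a = cos ((a / 2) *+ 2) by congr cos; rewrite mulr2n; field.
    by rewrite cos_mulr2n sin2cos2 mulr2n; ring.
  have h2 : sin (a / 2) <= a / 2 by apply: sin_le_id; lra.
  have h3 : 0 <= sin (a / 2) by apply: sin_ge0_pi; lra.
  have : sin (a / 2) ^+ 2 <= (a / 2) ^+ 2 by rewrite lerXn2r ?nnegrE //; lra.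
  by lra.
apply: (@le_trans _ _ ((1 - a ^+ 2) * a)).
  by rewrite ler_wpM2l // subr_ge0 expr_le1 // ltW.
rewrite ler_pM2r //; apply: le_trans ca; have := sqr_ge0 a; lra.
Qed.

(** The frequencies of [j] and [m - j] add up to [4 pi]. *)
Lemma carousel_eig_rev (R : realType) (m j : nat) : (j <= m)%N ->
  carousel_eig R m (m - j) = - carousel_eig R m j.
Proof.
move=> jm; rewrite /carousel_eig -mulrN -sumrN; congr (_ * _); apply: eq_bigr => d _.
have m0 : (m.+1%:R : R) != 0 by rewrite pnatr_eq0.
rewrite -sinN -[RHS](periodicn (@sinD2pi R) (2 * d.+1)); congr sin.
have -> : carousel_freq R m (m - j) = 4 * pi - carousel_freq R m j.
  have -> : (4 * pi : R) = (2 * m.+1)%:R * (2 * pi / m.+1%:R).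
    by rewrite natrM; move: (@pi R) (m.+1%:R : R) m0 => p N N0; field.
  by rewrite -mulrBl -natrB; [congr (_%:R * _); lia | lia].
have -> : pi *+ 2 *+ (2 * d.+1) = 4 * pi * d.+1%:R :> R.
  by rewrite -mulrnA -[LHS]mulr_natl !natrM; ring.
by ring.
Qed.

(** By reversal the first and the last [J] terms have equal sums; the terms between them are
    nonnegative and dropped. *)
Lemma sum_carousel_eig_ge (R : realType) (m l J : nat) : ~~ odd l -> (2 * J <= m.+1)%N ->
  2 * \sum_(j < J) carousel_eig R m j ^+ l <= \sum_(j < m.+1) carousel_eig R m j ^+ l.
Proof.
move=> el Jm; pose F j := carousel_eig R m j ^+ l.
have F0 j : 0 <= F j by rewrite exprn_even_ge0.
rewrite -[leRHS](big_mkord xpredT F) (@big_cat_nat _ _ _ J) //=; last lia.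
rewrite [X in _ + X](@big_cat_nat _ _ _ (m.+1 - J)) /=; [|lia..].
have -> : \sum_(m.+1 - J <= j < m.+1) F j = \sum_(0 <= j < J) F j.
  rewrite -{1}[(m.+1 - J)%N]add0n big_addn subKn; last lia.
  rewrite big_nat_rev big_nat [RHS]big_nat; apply: eq_bigr => j /andP[_ jJ].
  have -> : (0 + J - j.+1 + (m.+1 - J) = m - j)%N by lia.
  by rewrite /F carousel_eig_rev; [rewrite exprNn -signr_odd (negbTE el) mul1r | lia].
rewrite big_mkord mulr_natl mulr2n lerD2l lerDr.
by apply: sumr_ge0.
Qed.

(** Only the [2 J] dominant eigenvalues are kept. For these [a <= J pi / m.+1], so with [J] fixed
    the correction factor tends to 1 as [m] grows, and [1 / a] is [m.+1] times a term of the
    series. *)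
Lemma trace_odd_carousel_ge (R : realType) (m k J : nat) : ~~ odd m ->
  (0 < J)%N -> J%:R * pi <= m.+1%:R :> R ->
  m.+1%:R ^+ (4 * k) * ((1 - (J%:R * pi / m.+1%:R) ^+ 2) ^+ (4 * k) *
     (2 * pi_partial_sum R (4 * k) J)) <=
  \tr (arc_mx R (odd_carousel m) ^+ (4 * k)).
Proof.
move=> em J0 Jm; rewrite trace_odd_carousel_exp //.
have m0 : (0 : R) < m.+1%:R by rewrite ltr0n.
have m0' : (m.+1%:R : R) != 0 by rewrite pnatr_eq0.
have pi0 := @pi_gt0 R; have pi2 := @pi_ge2 R.
have J2 : (2 * J <= m.+1)%N.
  rewrite -(ler_nat R) natrM (le_trans _ Jm) // mulrC ler_wpM2l //.
apply: le_trans (sum_carousel_eig_ge _ (_ : ~~ odd (4 * k)) J2); last by rewrite oddM.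
rewrite pi_partial_sumE; set X := _ ^+ (4 * k); set Y := (1 - _) ^+ _; set Z := \sum_(j < J) _ ^+ _.
have -> : X * (Y * (2 * Z)) = 2 * (X * Y * Z) by ring.
rewrite ler_pM2l // {}/X {}/Y {}/Z mulr_sumr; apply: ler_sum => j _.
set d := J%:R * pi / m.+1%:R.
have d1 : d <= 1 by rewrite /d ler_pdivrMr // mul1r.
pose a : R := (2 * j + 1)%:R * pi / (2 * m.+1%:R).
have a0 : 0 < a by rewrite divr_gt0 ?mulr_gt0 // ltr0n; lia.
have ad : a <= d.
  rewrite /a /d ler_pdivrMr ?mulr_gt0 //.
  rewrite (_ : J%:R * pi / m.+1%:R * (2 * m.+1%:R) = (2 * J)%:R * pi); last first.
    by rewrite natrM; move: (@pi R) (m.+1%:R : R) m0' => p N N0; field.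
  by rewrite ler_pM2r // ler_nat; have := ltn_ord j; lia.
have h := carousel_eig_ge em (erefl a) (le_trans ad d1).
have aV : a^-1 = m.+1%:R * (2 / ((2 * j%:R + 1) * pi)).
  rewrite /a natrD natrM.
  have j0 : (2 * j%:R + 1 : R) != 0 by rewrite -natrM natr1 pnatr_eq0.
  move: (@pi R) (lt0r_neq0 pi0) (m.+1%:R : R) m0' => p p0 N N0.
  by field; rewrite N0 p0 j0.
have d2 : 0 <= 1 - d ^+ 2.
  by rewrite subr_ge0 expr_le1 // (le_trans _ ad) // ltW.
rewrite mulrAC -!exprMn -aV [a^-1 * _]mulrC.
apply: lerXn2r.
- by rewrite nnegrE mulr_ge0 // invr_ge0 ltW.
- by rewrite nnegrE (le_trans _ h) // mulr_ge0 ?invr_ge0 ?(ltW a0) // subr_ge0 expr_le1 // ?(le_trans ad) // ltW.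
apply: le_trans h; rewrite ler_pM2r ?invr_gt0 // lerD2l lerN2.
by rewrite lerXn2r ?nnegrE // ?(ltW a0) // (le_trans _ ad) // ltW.
Qed.

(** * Carousels of even order, by deletion of a vertex *)

Lemma delete_vertex_tournament (m : nat) (v : 'I_m.+1) (D : {set 'I_m.+1 * 'I_m.+1}) :
  tournament D -> tournament (delete_vertex v D).
Proof.
move=> /andP[/forallP irr /forallP tot]; apply/andP; split.
  by apply/forallP => x; rewrite inE /= irr.
apply/forallP => x; apply/forallP => y; apply/implyP => xy; rewrite !inE /=.
by have /forallP/(_ (lift v y))/implyP := tot (lift v x); apply; rewrite (inj_eq lift_inj).
Qed.

(** Cycle tuples avoiding [v] come from the smaller digraph; the error counts all tuples through
    [v]. *)
Lemma card_cycle_tuples_delete (m l : nat) (v : 'I_m.+1) (D : {set 'I_m.+1 * 'I_m.+1}) :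
  (#|cycle_tuples D l| <= #|cycle_tuples (delete_vertex v D) l| + (m.+1 ^ l - m ^ l))%N.
Proof.
pose f (t : l.-tuple 'I_m) : l.-tuple 'I_m.+1 := map_tuple (lift v) t.
have finj : injective f.
  by move=> s t /(congr1 val) /= /(inj_map (@lift_inj _ v)) st; apply: val_inj.
have sub : cycle_tuples D l \subset
    (f @: cycle_tuples (delete_vertex v D) l) :|: ~: (f @: [set: l.-tuple 'I_m])%SET.
  apply/fintype.subsetP => t; rewrite finset.in_setU finset.in_setC.
  case: (boolP (t \in (f @: [set: l.-tuple 'I_m])%SET)) => [/imsetP[s _ ->]|_]; last by rewrite orbT.
  rewrite /= orbF mem_imset // !inE /= map_inj_uniq; last exact: lift_inj.
  case/andP=> -> /=; case: s => s _ /=.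
  by rewrite cycle_map; apply: sub_cycle => x y; rewrite /= inE.
apply: leq_trans (subset_leq_card sub) _.
apply: leq_trans (leq_card_setU _ _) _.
rewrite card_imset // leq_add2l cardsCs finset.setCK card_imset // cardsT !card_tuple !card_ord.
exact: leqnn.
Qed.

Lemma carousel_tournament (n : nat) : tournament (carousel n).
Proof.
case: n => [|m] /=; first by apply: delete_vertex_tournament; exact: odd_carousel_tournament.
case: (boolP (odd m)) => om /=; last exact: odd_carousel_tournament.
by apply: delete_vertex_tournament; apply: odd_carousel_tournament; rewrite /= om.
Qed.

Lemma odd_carousel_cycles_ge (R : realType) (m k J : nat) : ~~ odd m -> (0 < k)%N ->
  (0 < J)%N -> J%:R * pi <= m.+1%:R :> R ->
  m.+1%:R ^+ (4 * k) * (1 + (1 - (J%:R * pi / m.+1%:R) ^+ 2) ^+ (4 * k) *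
     (2 * pi_partial_sum R (4 * k) J)) - 2 ^+ (4 * k) * (m.+1 ^ (4 * k) - m.+1 ^_ (4 * k))%:R <=
  2 ^+ (4 * k) * #|cycle_tuples (odd_carousel m) (4 * k)|%:R.
Proof.
move=> em k0 J0 Jm; have l1 : (1 < 4 * k)%N by lia.
have /andP[_ h] := trace_cycle_bounds R l1 (odd_carousel_tournament em).
rewrite lerBlDr card_cycle_tuples; last lia.
apply: le_trans h; rewrite trace_odd_carouselD1_exp // mulrDr mulr1 lerD2l.
exact: trace_odd_carousel_ge.
Qed.

Lemma ffact_le_exp (n l : nat) : (n ^_ l <= n ^ l)%N.
Proof.
by elim: l => [//|l IH]; rewrite ffactnSr expnSr leq_mul ?leq_subr.
Qed.

Lemma ffact_leS (n l : nat) : (n ^_ l <= n.+1 ^_ l)%N.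
Proof. by rewrite -!bin_ffact leq_mul2r leq_bin2l ?orbT. Qed.

(** One bound for both parities: the doubled error term covers the walks with repetitions and, for
    even [n], also the tuples through the deleted vertex. *)
Lemma carousel_cycles_ge (R : realType) (n k J : nat) : (0 < k)%N ->
  (0 < J)%N -> J%:R * pi <= n%:R :> R ->
  n%:R ^+ (4 * k) * (1 + (1 - (J%:R * pi / n%:R) ^+ 2) ^+ (4 * k) *
     (2 * pi_partial_sum R (4 * k) J)) - 2 ^+ (4 * k) * (2 * (n.+1%:R ^+ (4 * k) - (n ^_ (4 * k))%:R)) <=
  2 ^+ (4 * k) * (4 * k * #|dicycles (carousel n) (4 * k)|)%:R.
Proof.
move=> k0 J0 Jn; have pi0 := @pi_gt0 R; have pi2 := @pi_ge2 R.
rewrite -card_cycle_tuples; last lia.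
set l := (4 * k)%N.
have p2 : (0 : R) <= 2 ^+ l by rewrite exprn_ge0.
case: n Jn => [|m] Jn.
  exfalso; have : 0 < J%:R * pi :> R by rewrite mulr_gt0 // ltr0n.
  by move=> h; have := lt_le_trans h Jn; rewrite ltxx.
have e1 : (m.+1 ^_ l <= m.+1 ^ l)%N := ffact_le_exp _ _.
have e2 : (m.+1 ^ l <= m.+2 ^ l)%N by rewrite leq_exp2r // /l; lia.
have e3 : (m.+2 ^_ l <= m.+2 ^ l)%N := ffact_le_exp _ _.
have e4 := ffact_leS m.+1 l.
rewrite /carousel oddS; case: (boolP (odd m)) => om /=; last first.
  apply: (le_trans _ (odd_carousel_cycles_ge om k0 J0 Jn)); rewrite -/l lerD2l lerN2 ler_wpM2l //.
  by rewrite -natrX -natrB ?(leq_trans e1) // -natrM ler_nat; lia.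
have Jn' : J%:R * pi <= m.+2%:R :> R by apply: le_trans Jn _; rewrite ler_nat.
have h := @odd_carousel_cycles_ge R m.+1 k J _ k0 J0 Jn'.
have {}h := h (_ : ~~ odd m.+1); rewrite /= om -/l in h; have {}h := h isT.
have dl := card_cycle_tuples_delete l ord_max (odd_carousel m.+1).
move: h dl.
set N' := #|_|; move: #|_| => N h dl.
have dR : N'%:R <= N%:R + (m.+2%:R ^+ l - m.+1%:R ^+ l) :> R.
  by rewrite -!natrX -natrB // -natrD ler_nat.
rewrite natrB // !natrX in h.
have {e1}e1 : (m.+1 ^_ l)%:R <= m.+1%:R ^+ l :> R by rewrite -natrX ler_nat.
have {e2}e2 : m.+1%:R ^+ l <= m.+2%:R ^+ l :> R by rewrite -!natrX ler_nat.
have {e4}e4 : (m.+1 ^_ l)%:R <= (m.+2 ^_ l)%:R :> R by rewrite ler_nat.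
set P := 2 * pi_partial_sum R l J in h *.
have P0 : 0 <= P.
  by rewrite mulr_ge0 // pi_partial_sumE sumr_ge0 // => j _; exact: pi_term_ge0.
have x0 : 0 <= J%:R * pi / m.+1%:R :> R by rewrite divr_ge0 // mulr_ge0 ?pi_ge0.
have x1 : J%:R * pi / m.+1%:R <= 1 :> R by rewrite ler_pdivrMr ?mul1r // ltr0n.
have xy : J%:R * pi / m.+2%:R <= J%:R * pi / m.+1%:R :> R.
  by rewrite ler_wpM2l ?mulr_ge0 ?pi_ge0 // lef_pV2 ?posrE ?ltr0n // ler_nat.
have y0 : 0 <= J%:R * pi / m.+2%:R :> R by rewrite divr_ge0 // mulr_ge0 ?pi_ge0.
(* The main term increases with the order, so the bound for order [m.+2] yields the one for
   [m.+1]. *)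
have main : m.+1%:R ^+ l * (1 + (1 - (J%:R * pi / m.+1%:R) ^+ 2) ^+ l * P) <=
            m.+2%:R ^+ l * (1 + (1 - (J%:R * pi / m.+2%:R) ^+ 2) ^+ l * P).
  have w0 : 0 <= 1 - (J%:R * pi / m.+1%:R) ^+ 2 :> R by rewrite subr_ge0 expr_le1.
  have w1 : 1 - (J%:R * pi / m.+1%:R) ^+ 2 <= 1 - (J%:R * pi / m.+2%:R) ^+ 2 :> R.
    by rewrite lerD2l lerN2 lerXn2r.
  have wl0 := exprn_ge0 l w0.
  apply: ler_pM => //; first by apply: addr_ge0 => //; exact: mulr_ge0.
  by rewrite lerD2l ler_wpM2r // lerXn2r ?nnegrE // (le_trans w0).
move: main h; set X := m.+1%:R ^+ l * _; set Y := m.+2%:R ^+ l * _ => main h.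
have := ler_wpM2l p2 dR; have := ler_wpM2l p2 e1; have := ler_wpM2l p2 e4.
by rewrite !mulrDr !mulrN; lra.
Qed.

(** * Asymptotics *)

Local Open Scope classical_set_scope.

Lemma pi_partial_sum_nondec (R : realType) (l : nat) :
  {homo pi_partial_sum R l : n m / (n <= m)%N >-> n <= m}.
Proof.
apply/nondecreasing_seqP => n; rewrite !pi_partial_sumE big_ord_recr lerDl /=.
exact: pi_term_ge0.
Qed.

(** As [2 / pi <= 1], the terms are at most [1 / (2 j + 1)^2]; the bound is strengthened to
    [2 - 1 / n] to make the induction work. *)
Lemma pi_partial_sum_le (R : realType) (l n : nat) : (2 <= l)%N ->
  pi_partial_sum R l n <= 2.
Proof.
move=> l2; have pi0 := @pi_gt0 R; have pi2 := @pi_ge2 R.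
have odd0 j : (0 : R) < 2 * j%:R + 1 by rewrite -natrM natr1 ltr0n.
have term j : (2 / ((2 * j%:R + 1) * pi)) ^+ l <= ((2 * j%:R + 1)^-1) ^+ 2 :> R.
  have := odd0 j; set x := (2 * j%:R + 1 : R) => x0.
  have x1 : 1 <= x by rewrite /x lerDr mulr_ge0.
  have h0 : 0 <= 2 / (x * pi) by rewrite divr_ge0 // mulr_ge0 ?ltW.
  have h1 : 2 / (x * pi) <= x^-1.
    by rewrite ler_pdivrMr ?mulr_gt0 // mulKf // gt_eqF.
  apply: (@le_trans _ _ (x^-1 ^+ l)); first by rewrite lerXn2r ?nnegrE ?invr_ge0 ?(ltW x0).
  by rewrite ler_wiXn2l ?invr_ge0 ?(ltW x0) ?invf_le1.
rewrite pi_partial_sumE; apply: (@le_trans _ _ (\sum_(j < n) ((2 * j%:R + 1)^-1) ^+ 2)).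
  by apply: ler_sum => j _; exact: term.
case: n => [|n]; first by rewrite big_ord0.
apply: (@le_trans _ _ (2 - n.+1%:R^-1)); last by rewrite gerBl invr_ge0.
elim: n => [|n IH].
  by rewrite big_ord_recr big_ord0 /= mulr0 !add0r invr1 expr1n; lra.
rewrite big_ord_recr /=; apply: le_trans (lerD IH (lexx _)) _.
rewrite -[n.+2%:R]natr1; have : (0 : R) < n.+1%:R by [].
move: (n.+1%:R : R) => N N0.
rewrite -addrA lerD2l -lerBrDl opprK [leRHS]addrC.
have -> : N^-1 - (N + 1)^-1 = (N * (N + 1))^-1 by field; rewrite !gt_eqF // addr_gt0.
rewrite exprVn lef_pV2 ?posrE ?mulr_gt0 ?exprn_gt0 ?addr_gt0 ?mulr_gt0 //.
by nra.
Qed.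

Lemma pi_partial_sum_cvg (R : realType) (l : nat) : (2 <= l)%N -> cvgn (pi_partial_sum R l).
Proof.
move=> l2; apply: nondecreasing_is_cvgn; first exact: pi_partial_sum_nondec.
by exists 2 => _ [n _ <-]; exact: pi_partial_sum_le.
Qed.

(** A denominator-free form of [n^_l / n.+1^l >= 1 - l^2 / n.+1]. In the induction step the left
    side is nonpositive when [n.+1 <= l.+1^2]. *)
Lemma ffact_ge (R : realType) (n l : nat) :
  n.+1%:R ^+ l * (n.+1%:R - (l ^ 2)%:R) <= n.+1%:R * (n ^_ l)%:R :> R.
Proof.
elim: l => [|l IH]; first by rewrite expr0 mul1r ffactn0 mulr1 subr0.
have N0 : (0 : R) <= n.+1%:R by [].
case: (leqP n.+1 (l.+1 ^ 2)) => nl.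
  apply: (@le_trans _ _ 0); last by rewrite mulr_ge0.
  by rewrite mulr_ge0_le0 ?exprn_ge0 // subr_le0 ler_nat.
rewrite ffactnSr natrM mulrA natrB; last by nia.
have d0 : (0 : R) <= n%:R - l%:R by rewrite subr_ge0 ler_nat; nia.
apply: le_trans (ler_wpM2r d0 IH).
rewrite exprSr -!mulrA ler_wpM2l ?exprn_ge0 //.
rewrite !natrX -![_.+1%:R]natr1; have : (0 : R) <= l%:R by []; have : (0 : R) <= n%:R by [].
move: (n%:R : R) (l%:R : R) => x y x0 y0; rewrite -subr_ge0.
rewrite (_ : _ - _ = x * y + y + y ^+ 2 + y ^+ 3); last by ring.
by rewrite !addr_ge0 ?exprn_ge0 ?mulr_ge0.
Qed.

Lemma ffact_ratio_cvg (R : realType) (l : nat) :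
  (fun n : nat => n.+1%:R ^+ l / (n ^_ l)%:R : R) @ \oo --> (1 : R).
Proof.
have h : (fun n : nat => (n ^_ l)%:R / n.+1%:R ^+ l : R) @ \oo --> (1 : R).
  have hh : (fun n : nat => 1 - (l ^ 2)%:R * harmonic n : R) @ \oo --> (1 : R).
    have : (fun n : nat => 1 - (l ^ 2)%:R * harmonic n : R) @ \oo --> (1 - (l ^ 2)%:R * 0 : R).
      apply: cvgB; first exact: cvg_cst.
      by apply: cvgM; [exact: cvg_cst | exact: cvg_harmonic].
    by rewrite mulr0 subr0.
  apply: (@squeeze_cvgr _ _ _ _ (fun n => 1 - (l ^ 2)%:R * harmonic n) (fun=> 1)).
  - near=> n; apply/andP; split.
      rewrite ler_pdivlMr ?exprn_gt0 //.
      rewrite -(ler_pM2l (_ : (0 : R) < n.+1%:R)) //.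
      apply: le_trans (ffact_ge R n l).
      by rewrite le_eqVlt; apply/orP; left; apply/eqP; rewrite /harmonic /=; field; rewrite nat1r.
    rewrite ler_pdivrMr ?exprn_gt0 // mul1r -natrX ler_nat.
    apply: leq_trans (ffact_le_exp n l) _.
    by case: (posnP l) => [->|l0]; rewrite ?expn0 ?leq_exp2r.
  - exact: hh.
  - exact: cvg_cst.
rewrite (_ : (fun n : nat => _) = fun n : nat => ((n ^_ l)%:R / n.+1%:R ^+ l : R)^-1).
  by rewrite -[X in _ --> X]invr1; exact: cvgV.
by apply/funext => n; rewrite invf_div.
Unshelve. all: by end_near.
Qed.

(** A squeeze whose lower bound is given separately for each tolerance, because the cutoff [J] in
    the carousel bound depends on it. *)
Lemma cvg_of_eventual_bounds (R : realType) (f u : R^nat) (L : R) :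
  u @ \oo --> L -> (\forall n \near \oo, f n <= u n) ->
  (forall e, 0 < e -> \forall n \near \oo, L - e <= f n) -> f @ \oo --> L.
Proof.
move=> uL fu lf; apply/cvgrPdist_le => e e0.
near=> n; rewrite ler_norml; apply/andP; split.
  rewrite lerBrDl -lerBrDr opprK; apply: (@le_trans _ _ (u n)); first by near: n.
  by near: n; apply: (cvgr_le L uL); rewrite ltrDl.
by rewrite lerBlDl -lerBlDr; near: n; exact: lf.
Unshelve. all: by end_near.
Qed.

(** * Ratios to the expected number of cycles *)

Lemma expected_dicyclesE (R : realType) (n l : nat) : (0 < l)%N ->
  expected_dicycles R n l = (n ^_ l)%:R / (l%:R * 2 ^+ l).
Proof.
case: l => // l _; rewrite /expected_dicycles -bin_ffact factS !natrM /=.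
have l0 : (l.+1%:R : R) != 0 by [].
have p0 : (2 : R) ^+ l.+1 != 0 by rewrite expf_neq0.
by field; rewrite p0 nat1r l0.
Qed.

Lemma ratio_of_dicycles (R : realType) (n l x : nat) : (0 < l)%N -> (l <= n)%N ->
  x%:R / expected_dicycles R n l = (2 ^+ l * (l * x)%:R) / (n ^_ l)%:R.
Proof.
move=> l0 ln; rewrite expected_dicyclesE // invf_div mulrA natrM.
by congr (_ / _); ring.
Qed.

Lemma max_dicycles_ge (n l : nat) (D : {set 'I_n * 'I_n}) : tournament D ->
  (#|dicycles D l| <= max_dicycles n l)%N.
Proof. by move=> tD; rewrite /max_dicycles (bigD1 D) //= leq_maxl. Qed.

(** The carousel shows that the maximum is over a nonempty family. *)
Lemma max_dicycles_attained (n l : nat) :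
  exists2 D : {set 'I_n * 'I_n}, tournament D & max_dicycles n l = #|dicycles D l|.
Proof.
have [|D tD E] := @eq_bigmax_cond _ (fun D : {set 'I_n * 'I_n} => tournament D)
    (fun D => #|dicycles D l|).
  by apply/card_gt0P; exists (carousel n); exact: carousel_tournament.
by exists D.
Qed.

Lemma small_dicycles (n l : nat) (D : {set 'I_n * 'I_n}) : (n < l)%N -> #|dicycles D l| = 0%N.
Proof.
move=> nl; have := card_cycle_tuples D (leq_ltn_trans (leq0n n) nl).
rewrite (_ : #|cycle_tuples D l| = 0)%N; first by move/esym/eqP; rewrite muln_eq0 => /orP[|/eqP //]; lia.
apply: eq_card0 => c; rewrite inE; apply/negP => /andP[uc _].
have := max_card (mem c); rewrite card_ord (card_uniqP uc) size_tuple; lia.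
Qed.

Lemma dicycle_ratio_le (R : realType) (n k : nat) (D : {set 'I_n * 'I_n}) :
  (0 < k)%N -> tournament D -> (4 * k <= n)%N ->
  #|dicycles D (4 * k)|%:R / expected_dicycles R n (4 * k) <=
  n.+1%:R ^+ (4 * k) / (n ^_ (4 * k))%:R * (1 + 2 * limn (pi_partial_sum R (4 * k))).
Proof.
move=> k0 tD kn; rewrite ratio_of_dicycles //; last lia.
have f0 : (0 : R) < (n ^_ (4 * k))%:R by rewrite ltr0n ffact_gt0.
have S0 : cvgn (pi_partial_sum R (4 * k)) by apply: pi_partial_sum_cvg; lia.
rewrite [leRHS]mulrAC ler_pM2r ?invr_gt0 // (le_trans (dicycles_le R k0 tD)) //.
have h : pi_partial_sum R (4 * k) n <= limn (pi_partial_sum R (4 * k)).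
  by apply: nondecreasing_cvgn_le; [exact: pi_partial_sum_nondec | exact: S0].
apply: ler_pM.
- by rewrite exprn_ge0.
- rewrite addr_ge0 // mulr_ge0 // pi_partial_sumE sumr_ge0 // => j _.
  exact: pi_term_ge0.
- by rewrite lerXn2r ?nnegrE // ler_nat.
- by rewrite lerD2l ler_wpM2l.
Qed.

Lemma carousel_ratio_ge (R : realType) (k : nat) (e : R) : (0 < k)%N -> 0 < e ->
  \forall n \near \oo, 1 + 2 * limn (pi_partial_sum R (4 * k)) - e <=
    #|dicycles (carousel n) (4 * k)|%:R / expected_dicycles R n (4 * k).
Proof.
move=> k0 e0; set l := (4 * k)%N; set P := pi_partial_sum R l.
have cP : cvgn P by apply: pi_partial_sum_cvg; rewrite /l; lia.
(* The factor 2 in front of the series turns [e / 4] into [e / 2]; another [e / 4] goes to the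
   convergence of [w]. *)
have [J J0 PJ] : exists2 J, (0 < J)%N & limn P - e / 4 <= P J.
  have /cvgr_ge := cP; move=> /(_ (limn P - e / 4)) [|N _ hN]; first by rewrite ltrBlDr ltrDl; lra.
  by exists N.+1 => //; apply: hN => /=.
pose q (n : nat) : R := n.+1%:R ^+ l / (n ^_ l)%:R.
(* The lower bound of [carousel_cycles_ge] divided by [n^_l], with the factor [n^l / n^_l >= 1] of
   the main term dropped. *)
pose w (n : nat) : R := 1 + (1 - (J%:R * pi * n%:R^-1) ^+ 2) ^+ l * (2 * P J) - 2 ^+ l * 2 * (q n - 1).
have inv0 : (fun n : nat => n%:R^-1 : R) @ \oo --> (0 : R).
  by rewrite -cvg_shiftS; exact: cvg_harmonic.
have wc : w @ \oo --> 1 + 2 * P J.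
  rewrite (_ : 1 + 2 * P J = 1 + (1 - (J%:R * pi * 0) ^+ 2) ^+ l * (2 * P J) - 2 ^+ l * 2 * (1 - 1)); last first.
    by rewrite mulr0 expr0n subr0 expr1n subrr mulr0 subr0 mul1r.
  apply: cvgB; last by apply: cvgM; [exact: cvg_cst|]; apply: cvgB; [exact: ffact_ratio_cvg | exact: cvg_cst].
  apply: cvgD; first exact: cvg_cst.
  apply: cvgM; last exact: cvg_cst.
  apply: (cvg_comp _ (fun x : R => x ^+ l)); last exact: exprn_continuous.
  apply: cvgB; first exact: cvg_cst.
  apply: (cvg_comp _ (fun x : R => x ^+ 2)); last exact: exprn_continuous.
  by apply: cvgM => //; exact: cvg_cst.
near=> n.
have ln : (l <= n)%N by near: n; exact: nbhs_infty_ge.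
have Jn : J%:R * pi <= n%:R :> R by near: n; exact: nbhs_infty_ger.
have wn : 1 + 2 * P J - e / 4 <= w n by near: n; apply: (cvgr_ge _ wc); rewrite ltrBlDr ltrDl; lra.
rewrite ratio_of_dicycles //; last by rewrite /l; lia.
have f0 : (0 : R) < (n ^_ l)%:R by rewrite ltr0n ffact_gt0.
rewrite ler_pdivlMr //.
apply: le_trans (carousel_cycles_ge k0 J0 Jn); rewrite -/l -/P.
apply: (@le_trans _ _ (w n * (n ^_ l)%:R)).
  by rewrite ler_wpM2r // ?(ltW f0) //; lra.
rewrite /w mulrBl; apply: lerB.
  rewrite mulrC; apply: ler_wpM2r.
    apply: addr_ge0 => //; apply: mulr_ge0; last first.
      by apply: mulr_ge0 => //; rewrite /P pi_partial_sumE sumr_ge0 // => j _; exact: pi_term_ge0.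
    apply: exprn_ge0; rewrite subr_ge0 expr_le1 //.
      by rewrite ler_pdivrMr ?mul1r // ltr0n; move: ln; rewrite /l; lia.
    by rewrite divr_ge0 // mulr_ge0 ?pi_ge0.
  by rewrite -natrX ler_nat ffact_le_exp.
by rewrite /q -!mulrA mulrBl mul1r divfK ?gt_eqF.
Unshelve. all: by end_near.
Qed.

(** Stated for any count between that of the carousel and that of some tournament, so as to cover
    both the maximum and the carousel itself. *)
Lemma dicycles_limit (R : realType) (k : nat) (x : nat -> nat) : (0 < k)%N ->
  (forall n, (#|dicycles (carousel n) (4 * k)| <= x n)%N) ->
  (forall n, exists2 D : {set 'I_n * 'I_n}, tournament D & x n = #|dicycles D (4 * k)|) ->
  (fun n : nat => (x n)%:R / expected_dicycles R n (4 * k)) @ \oo -->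
    1 + 2 * limn (pi_partial_sum R (4 * k)).
Proof.
move=> k0 xge xE; set L := 1 + _.
apply: (@cvg_of_eventual_bounds _ _ (fun n : nat => n.+1%:R ^+ (4 * k) / (n ^_ (4 * k))%:R * L)).
- by rewrite -[X in _ --> X]mul1r; apply: cvgM; [exact: ffact_ratio_cvg | exact: cvg_cst].
- near=> n; have [D tD ->] := xE n; apply: dicycle_ratio_le => //.
  by near: n; exact: nbhs_infty_ge.
move=> e e0; near=> n.
apply: (@le_trans _ _ (#|dicycles (carousel n) (4 * k)|%:R / expected_dicycles R n (4 * k))).
  by near: n; exact: carousel_ratio_ge.
apply: ler_wpM2r; last by rewrite ler_nat.
by rewrite invr_ge0 expected_dicyclesE ?divr_ge0 ?mulr_ge0 ?exprn_ge0 //; lia.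
Unshelve. all: by end_near.
Qed.

(** For [n < l] the expected count is 0, and the exact identity holds there because [x n] vanishes
    too. *)
Lemma asymptotic_equality (R : realType) (l : nat) (x : nat -> nat) (L : R) : (0 < l)%N ->
  (forall n, (n < l)%N -> x n = 0%N) ->
  (fun n : nat => (x n)%:R / expected_dicycles R n l) @ \oo --> L ->
  exists eps : R^nat, eps @ \oo --> (0 : R) /\
    forall n : nat, (x n)%:R = (L + eps n) * expected_dicycles R n l.
Proof.
move=> l0 x0 xL; exists (fun n : nat => (x n)%:R / expected_dicycles R n l - L); split.
  by rewrite -[X in _ --> X](subrr L); apply: cvgB => //; exact: cvg_cst.
move=> n; rewrite addrC subrK; case: (ltnP n l) => nl; last first.
  rewrite divfK // expected_dicyclesE // mulf_neq0 ?invr_eq0 ?mulf_neq0 ?expf_neq0 //.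
    by rewrite pnatr_eq0 -lt0n ffact_gt0.
  by rewrite pnatr_eq0 -lt0n.
by rewrite x0 // !mul0r.
Qed.

Theorem theorem1p2 (R : realType) (k : nat) (hk : (0 < k)%N) :
  let L : R := 1 + 2 * limn (pi_partial_sum R (4 * k)) in
  [/\ cvgn (pi_partial_sum R (4 * k)),
      (exists eps : R^nat, eps @ \oo --> (0 : R) /\
         forall n : nat, (max_dicycles n (4 * k))%:R
           = (L + eps n) * expected_dicycles R n (4 * k)),
      cvgn (dicycle_ratio R (4 * k)) /\ dicycle_limit R (4 * k) = L
    & (exists eps : R^nat, eps @ \oo --> (0 : R) /\
         forall n : nat, #|dicycles (carousel n) (4 * k)|%:R
           = (L + eps n) * expected_dicycles R n (4 * k))].
Proof.
move=> L; have l0 : (0 < 4 * k)%N by lia.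
have maxL : dicycle_ratio R (4 * k) @ \oo --> L.
  apply: (@dicycles_limit R k (max_dicycles^~ (4 * k)%N) hk) => n; last exact: max_dicycles_attained.
  exact/max_dicycles_ge/carousel_tournament.
have carL : (fun n => #|dicycles (carousel n) (4 * k)|%:R / expected_dicycles R n (4 * k)) @ \oo --> L.
  apply: (@dicycles_limit R k (fun n => #|dicycles (carousel n) (4 * k)|) hk) => // n.
  by exists (carousel n) => //; exact: carousel_tournament.
split.
- by apply: pi_partial_sum_cvg; lia.
- apply: asymptotic_equality maxL => // n nl.
  by have [D _ ->] := max_dicycles_attained n (4 * k); exact: small_dicycles.
- by split; [apply/cvg_ex; exists L | exact: cvg_lim].
- by apply: asymptotic_equality carL => // n nl; exact: small_dicycles.
Qed.
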